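(* Let $q,p$ be complex with $q\ne0$, $|p|<1$, let $a,b,c,d$ be indeterminates (generic nonzero complex parameters such that no denominator below vanishes), let $m$ be a nonnegative integer, and let $r\ge 1$ be an integer. Then $$ \begin{aligned} &\sum_{0\le k_1<k_2<\dots<k_r\le m} q^{\sum_{i=1}^r(2i-1)k_i}\prod_{1\le i<j\le r} \theta(q^{k_i-k_j},aq^{k_i+k_j})^2\\ &\qquad\times \prod_{i=1}^r\frac{\theta(aq^{2k_i};p)\,(a,b,c,d, a^2q^{3-2r+m}/bcd,q^{-m};q,p)_{k_i}} {\theta(a;p)\,(q,aq/b,aq/c,aq/d,bcdq^{2r-2-m}/a,aq^{1+m};q,p)_{k_i}}\\ &=q^{-4\binom r3}\left(\frac a{bcdq}\right)^{\binom r2} \prod_{i=1}^r(q,b,c,d,a^2q^{3-2r+m}/bcd;q,p)_{i-1}\\ &\qquad\times \prod_{i=1}^r\frac{(q,aq;q,p)_m\, (aq^{2-i}/bc,aq^{2-i}/bd,aq^{2-i}/cd;q,p)_{m+1-r}} {(q,aq/b,aq/c,aq/d,aq^{2-2r+i}/bcd;q,p)_{m+1-i}}. \end{aligned} $$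
   Context: Theta functions: for $x\ne0$, $|p|<1$, $\theta(x)=\theta(x;p):=(x;p)_\infty(p/x;p)_\infty$ with $(x;p)_\infty=\prod_{k=0}^\infty(1-xp^k)$, and $\theta(x_1,\dots,x_s)=\prod_{i=1}^s\theta(x_i)$; $\theta(x,y)^2$ means $(\theta(x)\theta(y))^2$. Theta shifted factorials: for every integer $n$, $(a;q,p)_n=\prod_{k=0}^{n-1}\theta(aq^k)$ if $n\ge1$, $(a;q,p)_0=1$, and $(a;q,p)_n=1/\prod_{k=0}^{-n-1}\theta(aq^{n+k})$ if $n\le-1$; and $(a_1,\dots,a_s;q,p)_n=\prod_{i=1}^s(a_i;q,p)_n$. (A factor $1/(q;q,p)_{n}$ with $n<0$ is a product of theta values containing $\theta(1)=0$, hence equals $0$.) Expressions such as $x/bcd$ mean $x/(bcd)$. *)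

(* Defs.v *)
From HB Require Import structures.
From mathcomp Require Import all_boot all_order all_algebra.
From mathcomp Require Import all_classical all_reals all_analysis.
From mathcomp Require Import complex.

Set Implicit Arguments.
Unset Strict Implicit.
Unset Printing Implicit Defensive.

Import Order.TTheory GRing.Theory Num.Theory.
Import numFieldNormedType.Exports.

Local Open Scope classical_set_scope.
Local Open Scope ring_scope.
Local Open Scope complex_scope.

(* (x; p)_oo; the limit is taken for the topology of the modulus on R[i], and
   the partial products converge as soon as |p| < 1. *)
Definition qpoch_inf (R : realType) (p x : R[i]) : R[i] :=
  limn (fun n : nat => \prod_(0 <= k < n) (1 - x * p ^+ k) : R[i]^o).

Definition theta (R : realType) (p x : R[i]) : R[i] :=
  qpoch_inf p x * qpoch_inf p (p / x).

Definition thetas (R : realType) (p : R[i]) (xs : seq R[i]) : R[i] :=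
  \prod_(x <- xs) theta p x.

(* (a; q, p)_n for n : int. Since 0^-1 = 0, at n < 0 both (q; q, p)_n and its
   inverse are 0, which agrees with the convention 1 / (q; q, p)_n = 0. *)
Definition tfact (R : realType) (q p a : R[i]) (n : int) : R[i] :=
  match n with
  | Posz l => \prod_(0 <= k < l) theta p (a * q ^+ k)
  | Negz l => (\prod_(0 <= k < l.+1) theta p (a * q ^ (n + k%:Z)))^-1
  end.

Definition tfacts (R : realType) (q p : R[i]) (xs : seq R[i]) (n : int) :
    R[i] :=
  \prod_(a <- xs) tfact q p a n.

Definition strictly_increasing (r m : nat) (k : {ffun 'I_r -> 'I_m.+1}) :
    bool :=
  [forall i : 'I_r, forall j : 'I_r, (i < j)%N ==> (k i < k j)%N].

(* Main.v *)
Require Import Defs.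
From HB Require Import structures.
From mathcomp Require Import all_boot all_order all_fingroup all_algebra.
From mathcomp Require Import all_classical all_reals all_analysis.
From mathcomp Require Import complex.
From mathcomp Require Import ring lra zify.

Set Implicit Arguments.
Unset Strict Implicit.
Unset Printing Implicit Defensive.

Import Order.TTheory GRing.Theory Num.Theory.
Import numFieldNormedType.Exports.

Local Open Scope ring_scope.
Local Open Scope complex_scope.

(** Write [n = r - 1], [pq x y = theta (x y) theta (a x / y)] and
    [pp x u = u theta (a x u) theta (x / u)].  Weierstrass' three-term relation
    says that the [pq] are the pairings of vectors of a plane, [pp] being the
    pairing of two vectors of the first kind.  Apart from a weight [q ^ k_i]
    for each [i], the squared double product of the summand is the square of
    [prod_(i < j) pp (q ^ k_i) (q ^ k_j)].  A matrix whose entry in column [j] is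
    a product of [n - j] brackets of one family and [j] brackets of another has
    a determinant which factors into such pairings ([det_bracket_prod]).  Using
    the families [b q ^ l], [c q ^ l] for one copy of the double product and
    [d q ^ l], [e q ^ l], with [e = a ^ 2 q ^ (m + 1 - 2 n) / b c d], for the
    other copy, the double product squared becomes, up to a constant, a product
    of two determinants.  By the Cauchy-Binet formula ([cauchy_binet]) the
    multiple sum is then the determinant of a matrix of single sums.

    The brackets only shift the parameters of a very-well-poised term: the
    entry [(i, j)] is the Frenkel-Turaev sum ([frenkel_turaev]) with parameters
    [b q ^ (n - i)], [c q ^ i], [d q ^ (n - j)], [e q ^ j].  It is a product of a
    function of [i], a function of [j] and a product of brackets with the roles
    of the two kinds of vectors exchanged, so [det_bracket_prod] evaluates the
    determinant once more.  All products over pairs are indexed by the triangle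
    [i + l < n] and are compared factor by factor ([generic_sum]).

    This part needs only that theta satisfies [theta 1 = 0],
    [theta (1 / x) = - theta x / x] and Weierstrass' relation, and is done over
    any field.  For the product
    defining theta, Weierstrass' relation is derived from Jacobi's triple product
    identity ([jacobi_triple_product]): the product
    [theta (x y) theta (x / y)] becomes a double series, and summing it along
    the rotated coordinates [(s + t, s - t)] and [(s + t + 1, s - t)] separates
    [x] from [y].  The result has the shape
    [A x * B y - x / y * (B x * A y)] ([theta_rank2]), for which the relation is
    the Pluecker identity.

    The argument divides by theta values that may vanish although no
    denominator of the statement does, for instance [theta (b / c)].  Along the
    curve [(a t ^ 7, b t, c t ^ 2, d t ^ 3)] only countably many [t > 0] are
    exceptional, because the zeros of theta are powers of [p]; so there are good
    [t] tending to 1, and both sides are continuous ([multi_sum_theta]).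
    For [r > m + 1] both sides vanish: the sum is empty and the right-hand side
    contains the factor [1 / (q; q, p)_(m + 1 - r)]. *)

Ltac nonzero :=
  repeat first [ assumption | apply/andP; split | apply/expf_neq0
               | apply/mulf_neq0 | apply/invr_neq0 | exact: oner_neq0
               | rewrite oppr_eq0 | done ].
Ltac fieldnz := field; nonzero.

(** * Theta-like functions and shifted factorials *)

(** The algebraic content of being a theta function: everything up to the
    evaluation of the multiple sum follows from these three identities.  The
    extra parameter [a] makes Weierstrass' relation free of square roots; for
    [a = 1] it is the usual symmetric form. *)
Definition theta_like (F : fieldType) (th : F -> F) : Prop :=
  [/\ th 1 = 0,
      forall x, x != 0 -> th x^-1 = - x^-1 * th x &
      forall a x y u v, a != 0 -> x != 0 -> y != 0 -> u != 0 -> v != 0 ->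
        th (x * y) * th (a * x / y) * (th (u * v) * th (a * u / v)) -
        th (x * v) * th (a * x / v) * (th (u * y) * th (a * u / y)) =
        a * u / y * (th (y * v / a) * th (y / v)) *
        (th (a * x * u) * th (x / u))].

Section ThetaLike.
Variables (F : fieldType) (q : F) (th : F -> F).
Hypotheses (q0 : q != 0) (thP : theta_like th).

Let th1 : th 1 = 0. Proof. by have [] := thP. Qed.
Let thV x : x != 0 -> th x^-1 = - x^-1 * th x.
Proof. by have [_ + _] := thP; apply. Qed.
Let weier := let: And3 _ _ w := thP in w.
Let qX0 n : q ^+ n != 0. Proof. by rewrite expf_neq0. Qed.

Definition poch (x : F) (n : nat) : F := \prod_(i < n) th (x * q ^+ i).

(** Stability under shifts by [q] in both directions is what induction on the
    summation length needs, hence the two exponents. *)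
Definition generic (x : F) : Prop :=
  forall i j : nat, th (x * q ^+ i / q ^+ j) != 0.

Lemma poch0 x : poch x 0 = 1.
Proof. by rewrite /poch big_ord0. Qed.

Lemma pochS x n : poch x n.+1 = poch x n * th (x * q ^+ n).
Proof. by rewrite /poch big_ord_recr. Qed.

Lemma pochSl x n : poch x n.+1 = th x * poch (x * q) n.
Proof.
rewrite /poch big_ord_recl expr0 mulr1; congr (_ * _).
by apply: eq_bigr => i _; rewrite -mulrA -exprS.
Qed.

Lemma pochD x m n : poch x (m + n) = poch x m * poch (x * q ^+ m) n.
Proof.
rewrite /poch big_split_ord /=; congr (_ * _).
by apply: eq_bigr => i _; rewrite exprD mulrA.
Qed.

Lemma genericM x i j : generic x -> generic (x * q ^+ i / q ^+ j).
Proof.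
move=> gx k l; have := gx (i + k)%N (j + l)%N.
by rewrite !exprD invfM; congr (th _ != 0); ring.
Qed.

Lemma genericV x : x != 0 -> generic x -> generic x^-1.
Proof.
move=> x0 gx i j.
have -> : x^-1 * q ^+ i / q ^+ j = (x * q ^+ j / q ^+ i)^-1.
  by rewrite !invfM invrK; ring.
have ne0 : x * q ^+ j / q ^+ i != 0 by rewrite !mulf_neq0 ?invr_neq0.
by rewrite thV // mulf_neq0 // oppr_eq0 invr_eq0.
Qed.

Lemma generic_poch x n : generic x -> poch x n != 0.
Proof.
move=> gx; apply/prodf_neq0 => i _.
by have := gx i 0; rewrite expr0 divr1.
Qed.

Lemma generic_pochM x y i j n :
  generic x -> y = x * q ^+ i / q ^+ j -> poch y n != 0.
Proof. by move=> gx ->; apply/generic_poch/genericM. Qed.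

Lemma generic_thX x i : generic x -> th (x * q ^+ i) != 0.
Proof. by move=> gx; have := gx i 0; rewrite expr0 divr1. Qed.

Lemma generic_th x : generic x -> th x != 0.
Proof. by move/(generic_thX 0); rewrite expr0 mulr1. Qed.

(** The term of the terminating very-well-poised series 10V9.  The balancing
    condition [b c d e = a ^ 2 q ^ (n + 1)] is imposed only where it is used. *)
Definition vwp_term (a b c d e : F) (n k : nat) : F :=
  th (a * q ^+ (2 * k)) * (poch a k * poch b k * poch c k * poch d k *
     poch e k * poch (q ^- n) k) /
  (th a * (poch q k * poch (a * q / b) k * poch (a * q / c) k *
     poch (a * q / d) k * poch (a * q / e) k * poch (a * q ^+ n.+1) k)) *
  q ^+ k.

(** Raising [n] and [e] by one step changes the term by a multiple of a term
    of shorter length with all parameters shifted: the two quotients differ by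
    a Weierstrass combination that vanishes at [k = 0], which produces the
    factors theta (q ^ k) theta (a q ^ k). *)
Lemma vwp_step a b c d e n k :
  (k <= n)%N ->
  a != 0 -> b != 0 -> c != 0 -> d != 0 -> e != 0 ->
  generic a -> generic (a / b) -> generic (a / c) -> generic (a / d) ->
  generic (a / e) ->
  (forall i, (0 < i <= n.+1)%N -> th (q ^+ i) != 0) ->
  vwp_term a b c d (e * q) n.+1 k.+1 - vwp_term a b c d e n k.+1 =
  q * th (a * q ^+ 2) * th (a * q) * th b * th c * th d /
   (th (a * q / b) * th (a * q / c) * th (a * q / d)) *
  (a / e * th (e * q ^+ n.+1) * th (e / q ^+ n.+1 / a) /
   (th (a * q / e) * th (a * q ^+ n.+2) * th (a / e) * th (a * q ^+ n.+1))) *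
  vwp_term (a * q ^+ 2) (b * q) (c * q) (d * q) (e * q) n k.
Proof.
move=> le_kn a0 b0 c0 d0 e0 ga gb gc gd gae gq.
have pa : poch a k.+1 =
    th a * th (a * q) * poch (a * q ^+ 2) k / th (a * q ^+ k.+1).
  have ne : th (a * q ^+ k.+1) != 0 by have := ga k.+1 0; rewrite expr0 divr1.
  apply: (canRL (mulfK ne)); rewrite -pochS 2!pochSl mulrA.
  by congr (_ * _ * poch _ _); rewrite expr2; ring.
have pan : poch (a * q ^+ n.+1) k.+1 =
    th (a * q ^+ n.+1) * th (a * q ^+ n.+2) * poch (a * q ^+ n.+3) k /
    th (a * q ^+ n.+1 * q ^+ k.+1).
  have ne : th (a * q ^+ n.+1 * q ^+ k.+1) != 0.
    by have := ga (n.+1 + k.+1) 0; rewrite expr0 divr1 exprD mulrA.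
  apply: (canRL (mulfK ne)); rewrite -pochS 2!pochSl mulrA.
  by congr (_ * th _ * poch _ _); rewrite !exprS; ring.
have pan2 : poch (a * q ^+ n.+2) k.+1 =
    th (a * q ^+ n.+2) * poch (a * q ^+ n.+3) k.
  by rewrite pochSl; congr (_ * poch _ _); rewrite !exprS; ring.
have pN : poch (q ^- n) k.+1 = poch (q ^- n) k * th (q ^- n * q ^+ k).
  by rewrite pochS.
have pN1 : poch (q ^- n.+1) k.+1 = th (q ^- n.+1) * poch (q ^- n) k.
  rewrite pochSl; congr (_ * poch _ _).
  by rewrite exprSr; fieldnz.
have pb x : poch x k.+1 = th x * poch (x * q) k by rewrite pochSl.
have pac x : x != 0 -> poch (a * q / x) k.+1 =
    th (a * q / x) * poch (a * q ^+ 2 * q / (x * q)) k.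
  by move=> x0; rewrite pochSl; congr (_ * poch _ _); rewrite expr2; fieldnz.
have pe : poch (a * q / (e * q)) k.+1 =
    th (a / e) * th (a * q / e) * poch (a * q ^+ 2 * q / (e * q)) k /
    th (a * q ^+ k.+1 / e).
  have ne : th (a * q ^+ k.+1 / e) != 0.
    have := gae k.+1 0; rewrite expr0 divr1.
    by congr (th _ != 0); fieldnz.
  apply: (canRL (mulfK ne)).
  have -> : a * q / (e * q) = a / e by fieldnz.
  have -> : a * q ^+ k.+1 / e = a / e * q ^+ k.+1 by ring.
  rewrite -pochS 2!pochSl mulrA.
  congr (_ * th _ * poch _ _); first by ring.
  by rewrite expr2; fieldnz.
have pq : poch q k.+1 = poch q k * th (q ^+ k.+1) by rewrite pochS exprS.
have W := weier a0 (qX0 k.+1) e0 (oner_neq0 _)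
  (mulf_neq0 a0 (qX0 n.+1)).
have Wl : th (e * q * q ^+ k) * th (a * q ^+ k.+1 / e) * th (a * q ^+ n.+1) *
   th (q ^- n.+1) - th (a * q ^+ n.+1 * q ^+ k.+1) * th (q ^- n * q ^+ k) *
   th e * th (a / e) =
   a / e * th (e * q ^+ n.+1) * th (e / q ^+ n.+1 / a) * th (a * q ^+ k.+1) *
   th (q ^+ k.+1).
  apply: etrans (etrans W _).
    by congr (_ - _); rewrite !mulrA; congr (_ * _ * _ * _); congr th;
     rewrite ?exprS; fieldnz.
  by rewrite !mulrA; congr (_ * _ * _ * _ * _); try congr th;
     rewrite ?exprS; fieldnz.

have nz x i : generic x -> th (x * q ^+ i) != 0.
  by move=> gx; have := gx i 0; rewrite expr0 divr1.
have nz1 x : generic x -> th (x * q) != 0 by apply: (nz x 1%N).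
have nz0 x : generic x -> th x != 0 by move=> gx; have := nz x 0 gx; rewrite expr0 mulr1.
have e1 : th (a * q ^+ k.+1 / e) != 0 by rewrite mulrAC; apply: nz.
have e2 : th (a * q ^+ n.+1 * q ^+ k.+1) != 0.
  by rewrite -mulrA -exprD; apply: nz.
have e3 i : th (a * q ^+ i) != 0 by apply: nz.
have e4 : th (a * q) != 0 by apply: nz1.
have e5 : th a != 0 by apply: nz0.
have mq x : a * q / x = a / x * q by ring.
have pz x y n' : generic x -> y = x * q ^+ 2 -> poch y n' != 0.
  by move=> gx ->; apply: (generic_pochM (i := 2) (j := 0) _ gx);
     rewrite expr0 divr1.
have f1 x : x != 0 -> generic (a / x) ->
    poch (a * q ^+ 2 * q / (x * q)) k != 0 /\ th (a * q / x) != 0.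
  move=> x0 gx; split; last by rewrite mq nz1.
  by apply: (pz _ _ _ gx); fieldnz.
have [fb fb'] := f1 _ b0 gb; have [fc fc'] := f1 _ c0 gc.
have [fd fd'] := f1 _ d0 gd; have [fe fe'] := f1 _ e0 gae.
have ge0 : th (a / e) != 0 by apply: nz0.
have gqk : poch q k != 0.
  apply/prodf_neq0 => i _; rewrite -exprS; apply: gq.
  by rewrite /= ltnS ltnW // (leq_trans (ltn_ord i)).
have gqk1 : th (q ^+ k.+1) != 0 by apply: gq; rewrite /= ltnS.
have gp2 : poch (a * q ^+ 2) k != 0 by apply: (pz _ _ _ ga).
have gpn3 : poch (a * q ^+ n.+3) k != 0.
  by apply: (generic_pochM (i := n.+3) (j := 0) _ ga); rewrite expr0 divr1.
set V := vwp_term (a * q ^+ 2) _ _ _ _ _ _.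
rewrite /vwp_term pa pan pan2 pN pN1 pe pq (pb b) (pb c) (pb d) (pb e)
  (pochS (e * q)) !pac //.
(* The difference of the two terms is C times the left-hand side of Wl. *)
pose C := q * th (a * q ^+ 2) * th (a * q) * th b * th c * th d /
   (th (a * q / b) * th (a * q / c) * th (a * q / d)) /
   (th (a * q / e) * th (a * q ^+ n.+2) * th (a / e) * th (a * q ^+ n.+1)) * V /
   (th (a * q ^+ k.+1) * th (q ^+ k.+1)).
have -> : q * th (a * q ^+ 2) * th (a * q) * th b * th c * th d /
   (th (a * q / b) * th (a * q / c) * th (a * q / d)) *
  (a / e * th (e * q ^+ n.+1) * th (e / q ^+ n.+1 / a) /
   (th (a * q / e) * th (a * q ^+ n.+2) * th (a / e) * th (a * q ^+ n.+1))) *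
   V = C * (a / e * th (e * q ^+ n.+1) * th (e / q ^+ n.+1 / a) *
     th (a * q ^+ k.+1) * th (q ^+ k.+1)).
  rewrite /C; clear C; move: V (e3 n.+1) (e3 n.+2) (e3 k.+1) => {}V ? ? ?; fieldnz.
rewrite -Wl /C /V /vwp_term.
have -> : a * q ^+ 2 * q ^+ n.+1 = a * q ^+ n.+3.
  by rewrite -mulrA -exprD.
have -> : a * q ^+ (2 * k.+1) = a * q ^+ 2 * q ^+ (2 * k).
  by rewrite mulnS exprD mulrA.
have -> : q ^+ k = q ^+ k.+1 / q by rewrite exprS; fieldnz.
move: (e3 n.+1) (e3 n.+2) (e3 k.+1) (e3 2) e1 => ? ? ? ? ?; fieldnz.
Qed.

(** * The Frenkel-Turaev summation *)

Lemma vwp_term0 a b c d e n : th a != 0 -> vwp_term a b c d e n 0 = 1.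
Proof.
by move=> ta; rewrite /vwp_term muln0 !poch0 expr0 !mulr1 divff.
Qed.

Lemma poch_negE n k : (n < k)%N -> poch (q ^- n) k = 0.
Proof.
move=> lt_nk; rewrite /poch (bigD1 (Ordinal lt_nk)) //=.
by rewrite mulVf // th1 mul0r.
Qed.

Lemma frenkel_turaev_rec a b c d n (e := a ^+ 2 * q ^+ n.+1 / (b * c * d)) :
  a != 0 -> b != 0 -> c != 0 -> d != 0 ->
  generic a -> generic (a / b) -> generic (a / c) -> generic (a / d) ->
  generic (b * c * d / a) ->
  (forall i, (0 < i <= n.+1)%N -> th (q ^+ i) != 0) ->
  \sum_(k < n.+2) vwp_term a b c d (e * q) n.+1 k =
  \sum_(k < n.+1) vwp_term a b c d e n k +
  q * th (a * q ^+ 2) * th (a * q) * th b * th c * th d /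
   (th (a * q / b) * th (a * q / c) * th (a * q / d)) *
  (a / e * th (e * q ^+ n.+1) * th (e / q ^+ n.+1 / a) /
   (th (a * q / e) * th (a * q ^+ n.+2) * th (a / e) * th (a * q ^+ n.+1))) *
  \sum_(k < n.+1) vwp_term (a * q ^+ 2) (b * q) (c * q) (d * q) (e * q) n k.
Proof.
move=> a0 b0 c0 d0 ga gb gc gd ge gq.
have e0 : e != 0 by rewrite /e; nonzero.
have gae : generic (a / e).
  have -> : a / e = (b * c * d / a) * q ^+ 0 / q ^+ n.+1 by rewrite /e; fieldnz.
  exact: genericM.
have ta : th a != 0 by apply: generic_th ga.
have -> : \sum_(k < n.+1) vwp_term a b c d e n k =
          \sum_(k < n.+2) vwp_term a b c d e n k.
  rewrite [RHS]big_ord_recr /= [X in _ = _ + X](_ : _ = 0) ?addr0 //.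
  by rewrite /vwp_term poch_negE // !(mulr0, mul0r).
apply/eqP; rewrite addrC -subr_eq -sumrB big_ord_recl !vwp_term0 // subrr add0r.
rewrite mulr_sumr; apply/eqP/eq_bigr => k _.
by apply: vwp_step => //; rewrite -ltnS.
Qed.

(** The closed form obeys the same recursion as the sum.  Once the common
    shifted factorials are cancelled, this is one instance of Weierstrass'
    relation. *)
Lemma frenkel_turaev_closed_rec a b c d n
    (e := a ^+ 2 * q ^+ n.+1 / (b * c * d)) :
  a != 0 -> b != 0 -> c != 0 -> d != 0 ->
  generic a -> generic (a / b) -> generic (a / c) -> generic (a / d) ->
  generic (b * c * d / a) ->
  poch (a * q) n.+1 * poch (a * q / (b * c)) n.+1 *
   poch (a * q / (b * d)) n.+1 * poch (a * q / (c * d)) n.+1 /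
   (poch (a * q / b) n.+1 * poch (a * q / c) n.+1 * poch (a * q / d) n.+1 *
    poch (a * q / (b * c * d)) n.+1) =
  poch (a * q) n * poch (a * q / (b * c)) n *
   poch (a * q / (b * d)) n * poch (a * q / (c * d)) n /
   (poch (a * q / b) n * poch (a * q / c) n * poch (a * q / d) n *
    poch (a * q / (b * c * d)) n) +
  q * th (a * q ^+ 2) * th (a * q) * th b * th c * th d /
   (th (a * q / b) * th (a * q / c) * th (a * q / d)) *
  (a / e * th (e * q ^+ n.+1) * th (e / q ^+ n.+1 / a) /
   (th (a * q / e) * th (a * q ^+ n.+2) * th (a / e) * th (a * q ^+ n.+1))) *
  (poch (a * q * q ^+ 2) n * poch (a * q / (b * c)) n *
   poch (a * q / (b * d)) n * poch (a * q / (c * d)) n /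
   (poch (a * q / b * q) n * poch (a * q / c * q) n * poch (a * q / d * q) n *
    poch (a / (b * c * d)) n)).
Proof.
move=> a0 b0 c0 d0 ga gb gc gd ge.
pose A := a * q ^+ n.+1.
pose Y := a * q ^+ n / (b * c * d).
have A0 : A != 0 by rewrite /A; nonzero.
have Y0 : Y != 0 by rewrite /Y; nonzero.
have gi : generic (a / (b * c * d)) by rewrite -invf_div; apply: genericV => //; nonzero.
have e1 : th (a * q / e) = - Y^-1 * th Y.
  rewrite -thV //; congr th; rewrite /e /Y (exprS q); fieldnz.
have e3 : a / e = (Y * q)^-1.
  rewrite /e /Y (exprS q); fieldnz.
have e2 : th (a / e) = - (Y * q)^-1 * th (Y * q).
  by rewrite e3 thV //; nonzero.
have e4 : th (e * q ^+ n.+1) = th (A ^+ 2 / (b * c * d)).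
  congr th; rewrite /e /A; fieldnz.
have e5 : th (e / q ^+ n.+1 / a) = th (a / (b * c * d)).
  congr th; rewrite /e; fieldnz.

have p2 x : generic x -> poch (x * q) n = poch x n * th (x * q ^+ n) / th x.
  by move=> gx; rewrite -pochS pochSl mulrAC divff ?mul1r // generic_th.
have gX x i : generic x -> generic (x * q ^+ i).
  by move=> gx; have := genericM i 0 gx; rewrite expr0 divr1.
have gq x : generic (a / x) -> generic (a * q / x).
  by move=> gx; have := gX _ 1 gx; rewrite expr1 mulrAC.
have pa : poch (a * q * q ^+ 2) n =
    poch (a * q) n * th A * th (a * q ^+ n.+2) / (th (a * q) * th (a * q ^+ 2)).
  have -> : a * q * q ^+ 2 = a * q * q * q by rewrite expr2; ring.
  have g1 : generic (a * q) by have := gX _ 1 ga; rewrite expr1.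
  have g2 : generic (a * q * q) by have := gX _ 1 g1; rewrite expr1.
  rewrite (p2 (a * q * q)) // (p2 (a * q)) //.
  have -> : a * q * q * q ^+ n = a * q ^+ n.+2 by rewrite !(exprS q); ring.
  have -> : a * q * q ^+ n = A by rewrite /A (exprS q); ring.
  have -> : a * q * q = a * q ^+ 2 by ring.
  have := generic_th g1; have := generic_thX 2 ga => ? ?; fieldnz.
have pi : poch (a / (b * c * d)) n =
    th (a / (b * c * d)) * poch (a * q / (b * c * d)) n / th Y.
  have -> : Y = a / (b * c * d) * q ^+ n by rewrite /Y; ring.
  have -> : a * q / (b * c * d) = a / (b * c * d) * q by ring.
  rewrite -pochSl pochS mulfK //; exact: generic_thX.
have pn x : x != 0 -> th (a * q / x * q ^+ n) = th (A / x).
  by move=> x0; congr th; rewrite /A (exprS q); ring.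
have tA x : generic (a / x) -> th (A / x) != 0.
  by move=> gx; have := generic_thX n.+1 gx; rewrite mulrAC.
(* The scaling x = 1 makes the first argument the longest one, A. *)
have := weier (a := A ^+ 2 / (b * c)) (x := 1) (y := A) (u := d^-1) (v := A / b).
have -> : A ^+ 2 / (b * c) * d^-1 / A = Y * q.
  rewrite /A /Y (exprS q); fieldnz.
have -> : A ^+ 2 / (b * c) * 1 / A = A / (b * c) by fieldnz.
have -> : d^-1 * (A / b) = A / (b * d) by fieldnz.
have -> : A ^+ 2 / (b * c) / d / (A / b) = A / (c * d) by fieldnz.
have -> : A ^+ 2 / (b * c) * 1 / (A / b) = A / c by fieldnz.
have -> : d^-1 * A = A / d by fieldnz.
have -> : A * (A / b) / (A ^+ 2 / (b * c)) = c by fieldnz.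
have -> : A / (A / b) = b by fieldnz.
have -> : A ^+ 2 / (b * c) * 1 / d = A ^+ 2 / (b * c * d) by fieldnz.
rewrite invrK !mul1r => W.
have {}W : th A * th (A / (b * c)) * th (A / (b * d)) * th (A / (c * d)) =
    th (A / b) * th (A / c) * th (A / d) * th (Y * q) +
    Y * q * th b * th c * th d * th (A ^+ 2 / (b * c * d)).
  rewrite addrC; apply/eqP; rewrite -subr_eq; apply/eqP.
  apply: etrans (etrans (W _ _ _ _ _) _); nonzero; ring.
have nA : th A != 0 by apply: generic_thX.
have na i : th (a * q ^+ i) != 0 by apply: generic_thX.
have na1 : th (a * q) != 0 by rewrite -[q]expr1.
have nax x : generic (a / x) -> poch (a * q / x) n != 0 /\ th (a * q / x) != 0.
  by move/gq => gx; rewrite generic_poch ?generic_th.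
have [pb tb] := nax _ gb; have [pc tc] := nax _ gc; have [pd td] := nax _ gd.
have [pbcd tbcd] := nax _ gi.
have nb := tA _ gb; have nc := tA _ gc; have nd := tA _ gd.
have nYq : th (Y * q) != 0.
  have -> : Y * q = A / (b * c * d) by rewrite /Y /A (exprS q); ring.
  exact: tA.
have nY : th Y != 0.
  have -> : Y = a / (b * c * d) * q ^+ n by rewrite /Y; ring.
  exact: generic_thX.
have ni := generic_th gi.
rewrite !pochS !pn; nonzero.
have -> : a * q * q ^+ n = A by rewrite /A (exprS q); ring.
have -> : th (A / (b * c * d)) = th (Y * q).
  by congr th; rewrite /A /Y (exprS q); ring.
rewrite (p2 _ (gq _ gb)) (p2 _ (gq _ gc)) (p2 _ (gq _ gd)).
rewrite !pn; nonzero.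
rewrite pa pi e1 e2 e3 e4 e5 -/A.
set x1 := th A in nA *; set x2 := th (A / (b * c)); set x3 := th (A / (b * d)).
set x4 := th (A / (c * d)).
pose C := poch (a * q) n * poch (a * q / (b * c)) n *
   poch (a * q / (b * d)) n * poch (a * q / (c * d)) n /
   (poch (a * q / b) n * poch (a * q / c) n * poch (a * q / d) n *
    poch (a * q / (b * c * d)) n) / 
    (th (A / b) * th (A / c) * th (A / d) * th (Y * q)).
transitivity (C * (x1 * x2 * x3 * x4)).
  rewrite /C; clear C; clearbody A Y; fieldnz.
rewrite W {}/C; move: (na 2) (na n.+2) => ? ?.
clearbody A Y x1 x2 x3 x4; fieldnz.
Qed.

(** Induction on the length, for all parameters at once: the recursion relates
    length [n + 1] at [(a, b, c, d)] to length [n] at [(a, b, c, d)] and at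
    [(a q ^ 2, b q, c q, d q)]. *)
Theorem frenkel_turaev n a b c d :
  a != 0 -> b != 0 -> c != 0 -> d != 0 ->
  generic a -> generic (a / b) -> generic (a / c) -> generic (a / d) ->
  generic (b * c * d / a) ->
  (forall i, (0 < i <= n)%N -> th (q ^+ i) != 0) ->
  \sum_(k < n.+1)
     vwp_term a b c d (a ^+ 2 * q ^+ n.+1 / (b * c * d)) n k =
  poch (a * q) n * poch (a * q / (b * c)) n *
   poch (a * q / (b * d)) n * poch (a * q / (c * d)) n /
   (poch (a * q / b) n * poch (a * q / c) n * poch (a * q / d) n *
    poch (a * q / (b * c * d)) n).
Proof.
elim: n a b c d => [|n IHn] a b c d a0 b0 c0 d0 ga gb gc gd ge gq.
  by rewrite big_ord_recl big_ord0 vwp_term0 ?generic_th // !poch0 !mulr1 divr1 addr0.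
have gM x y i : generic x -> y = x * q ^+ i -> generic y.
  by move=> gx ->; have := genericM i 0 gx; rewrite expr0 divr1.
set e := a ^+ 2 * q ^+ n.+1 / (b * c * d).
have -> : a ^+ 2 * q ^+ n.+2 / (b * c * d) = e * q by rewrite /e (exprSr q); ring.
rewrite frenkel_turaev_rec // IHn //; last first.
  by move=> i /andP[i0 le_in]; apply: gq; rewrite i0 ltnW.
have -> : e * q = (a * q ^+ 2) ^+ 2 * q ^+ n.+1 / (b * q * (c * q) * (d * q)).
  rewrite /e; fieldnz.
rewrite IHn; nonzero; first last.
- by move=> i /andP[i0 le_in]; apply: gq; rewrite i0 ltnW.
- by apply: (gM _ _ 1 ge); fieldnz.
- by apply: (gM _ _ 1 gd); fieldnz.
- by apply: (gM _ _ 1 gc); fieldnz.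
- by apply: (gM _ _ 1 gb); fieldnz.
- by apply: (gM _ _ 2 ga).
rewrite frenkel_turaev_closed_rec // -/e.
congr (_ + _ * (poch _ _ * poch _ _ * poch _ _ * poch _ _ /
  (poch _ _ * poch _ _ * poch _ _ * poch _ _))); fieldnz.
Qed.

End ThetaLike.

(** * Determinants of products of brackets *)

Section BracketDeterminant.
Variables (F : fieldType) (T U : Type) (D : pred T) (E : pred U).
Variables (pp : T -> T -> F) (pq : T -> U -> F) (qr : U -> U -> F).
Hypothesis plucker : forall x u y v, D x -> D u -> E y -> E v ->
  pq x y * pq u v - pq x v * pq u y = pp x u * qr y v.

(** Column [j] takes [n - j] brackets with the vectors [Q l] and [j] with the
    vectors [R l], so that neighbouring columns share all but one bracket. *)
Definition bracket_prod (n : nat) (Q R : nat -> U) (x : T) (j : nat) : F :=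
  \prod_(l < n - j) pq x (Q l) * \prod_(l < j) pq x (R l).

Lemma det_scale n (A : 'M[F]_n) (a b : 'I_n -> F) :
  \det (\matrix_(i, j) (a i * A i j * b j)) =
  \prod_i a i * \det A * \prod_i b i.
Proof.
have -> : \matrix_(i, j) (a i * A i j * b j) =
    diag_mx (\row_i a i) *m A *m diag_mx (\row_i b i).
  by apply/matrixP => i j; rewrite mul_mx_diag mul_diag_mx !mxE.
rewrite !det_mulmx !det_diag.
by congr (_ * _ * _); apply: eq_bigr => i _; rewrite mxE.
Qed.

(** The combination of two neighbouring columns that vanishes at the vector
    [x]; what is left is a column of the matrix of the next smaller size. *)
Lemma bracket_prod_elim n Q R (x u : T) j : (j <= n)%N ->
  D x -> D u -> E (Q (n - j)%N) -> E (R j) ->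
  pq x (R j) * bracket_prod n.+1 Q R u j -
  pq x (Q (n - j)%N) * bracket_prod n.+1 Q R u j.+1 =
  - (pp x u * qr (Q (n - j)%N) (R j)) * bracket_prod n Q R u j.
Proof.
move=> le_jn Dx Du EQ ER; rewrite -plucker // /bracket_prod subSS subSn // !big_ord_recr /=.
ring.
Qed.

(** Each entry is a form of degree [n] in a vector of a plane, so the
    determinant is a Vandermonde product in the [P i] times the determinant of
    the coefficients; the latter vanishes when some [Q l] is proportional to
    some [R i] with [l + i < n], since this vector then divides all columns.
    The proof eliminates the first row by column operations, which needs the
    nonvanishing of the brackets of [P] with [R]. *)
Theorem det_bracket_prod n (P : 'I_n.+1 -> T) (Q R : nat -> U) :
  (forall i, D (P i)) -> (forall l, E (Q l)) -> (forall l, E (R l)) ->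
  (forall i l, (l < n)%N -> pq (P i) (R l) != 0) ->
  \det (\matrix_(i < n.+1, j < n.+1) bracket_prod n Q R (P i) j) =
  \prod_(i < n.+1) \prod_(j < n.+1 | (i < j)%N) pp (P i) (P j) *
  \prod_(i < n.+1) \prod_(l < n - i) qr (Q l) (R i).
Proof.
move=> + EQ ER; elim: n P => [|n IHn] P DP PR0.
  rewrite det_mx11 mxE /bracket_prod !big_ord_recl !big_ord0 /=.
  by rewrite big_mkcond big_ord_recl big_ord0 /= !mulr1.
set M := \matrix_(i, j) _.
(* Column j is combined with column j + 1 so as to vanish at P 0; only the
   last column keeps a nonzero entry in the first row. *)
pose C := \matrix_(i < n.+2, j < n.+2)
  if i == j then (if (j < n.+1)%N then pq (P ord0) (R j) else 1)
  else if (i == j.+1 :> nat) then - pq (P ord0) (Q (n - j)%N) else 0.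
have detC : \det C = \prod_(j < n.+1) pq (P ord0) (R j).
  rewrite det_trig; last first.
    apply/is_trig_mxP => i j lt_ij; rewrite mxE.
    by rewrite -val_eqE /= ltn_eqF // ltn_eqF // (leq_trans lt_ij).
  rewrite big_ord_recr /= mxE eqxx ltnn mulr1.
  by apply: eq_bigr => i _; rewrite mxE eqxx /= ltn_ord.
have C_neq0 : \det C != 0.
  by rewrite detC; apply/prodf_neq0 => i _; apply: PR0.
have MC i (j : 'I_n.+1) : (M *m C) i (widen_ord (leqnSn _) j) =
   - (pp (P ord0) (P i) * qr (Q (n - j)%N) (R j)) * bracket_prod n Q R (P i) j.
  have le_jn : (j <= n)%N by rewrite -ltnS.
  rewrite -(bracket_prod_elim le_jn (DP ord0) (DP i) (EQ _) (ER _)) mxE.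
  have ne : lift ord0 j != widen_ord (leqnSn _) j by rewrite -val_eqE /= /bump; lia.
  rewrite (bigD1 (widen_ord (leqnSn _) j)) //= (bigD1 (lift ord0 j)) //=.
  rewrite big1 ?addr0 => [|k /andP[k1 k2]]; last first.
    by rewrite !mxE (negbTE k1) ifN ?mulr0 //.
  rewrite !mxE eqxx /= ltn_ord (negbTE ne) /bump /= add1n eqxx.
  by rewrite mulrN mulrC [X in _ - X]mulrC.
have MCmax i : (M *m C) i ord_max = bracket_prod n.+1 Q R (P i) n.+1.
  rewrite mxE (bigD1 ord_max) //= big1 ?addr0 => [|k k1].
    by rewrite !mxE eqxx ltnn mulr1.
  rewrite !mxE (negbTE k1) ifN ?mulr0 //.
  by rewrite ltn_eqF.
apply: (mulIf C_neq0); rewrite -det_mulmx (expand_det_row _ ord0).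
rewrite (bigD1 ord_max) //= big1 ?addr0 => [|k k1]; last first.
  have lt_kn : (k < n.+1)%N by have := ltn_ord k; move: k1; rewrite -val_eqE /=; lia.
  have -> : k = widen_ord (leqnSn _) (Ordinal lt_kn) by apply: val_inj.
  have pp0 : pp (P ord0) (P ord0) * qr (Q (n - k)%N) (R k) = 0.
    by rewrite -plucker // mulrC subrr.
  by rewrite MC /= pp0 oppr0 !mul0r.
rewrite MCmax /cofactor /= add0n.
have -> : row' ord0 (col' ord_max (M *m C)) =
   \matrix_(i, j) (- pp (P ord0) (P (lift ord0 i)) *
      (\matrix_(i, j) bracket_prod n Q R ((P \o lift ord0) i) j) i j *
      qr (Q (n - j)%N) (R j)).
  apply/matrixP => i j; rewrite 2![LHS]mxE.
  have -> : lift ord_max j = widen_ord (leqnSn _) j.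
    by apply: val_inj; rewrite /= /bump leqNgt ltn_ord.
  rewrite MC !mxE /=; ring.
rewrite det_scale IHn; first last.
- by move=> i l lt_ln; apply: PR0; rewrite ltnW.
- by move=> i; apply: DP.
rewrite detC /bracket_prod subnn big_ord0 mul1r.
rewrite [\prod_(i < n.+2) \prod_(j < _ | _) _]big_ord_recl /=.
rewrite prodrN card_ord.
have -> : \prod_(j < n.+2 | (0 < j)%N) pp (P ord0) (P j) =
   \prod_(i < n.+1) pp (P ord0) (P (lift ord0 i)).
  by rewrite [LHS]big_mkcond [LHS]big_ord_recl /= mul1r; apply: eq_bigr.
have -> : \prod_(i < n.+1) \prod_(j < n.+2 | (lift ord0 i < j)%N)
      pp (P (lift ord0 i)) (P j) =
   \prod_(i < n.+1) \prod_(j < n.+1 | (i < j)%N)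
      pp (P (lift ord0 i)) (P (lift ord0 j)).
  apply: eq_bigr => i _.
  by rewrite [LHS]big_mkcond [LHS]big_ord_recl /= mul1r [RHS]big_mkcond; apply: eq_bigr.
have -> : \prod_(i < n.+2) \prod_(l < n.+1 - i) qr (Q l) (R i) =
   \prod_(i < n.+1) (\prod_(l < n - i) qr (Q l) (R i) *
      qr (Q (n - i)%N) (R i)).
  rewrite big_ord_recr /= subnn big_ord0 mulr1; apply: eq_bigr => i _.
  have le_in : (i <= n)%N by rewrite -ltnS.
  by rewrite subSn // big_ord_recr.
rewrite big_split /= -[in RHS]mulrA.
have s : (-1) ^+ n.+1 * (-1) ^+ n.+1 = 1 :> F by rewrite -exprMn mulrNN mulr1 expr1n.
rewrite -[RHS]mul1r -[X in _ = X * _]s; ring.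
Qed.

End BracketDeterminant.

(** * The Cauchy-Binet formula *)

Lemma strictly_increasingP r m (k : {ffun 'I_r -> 'I_m.+1}) :
  reflect (forall i j : 'I_r, (i < j)%N -> (k i < k j)%N)
          (strictly_increasing k).
Proof.
apply: (iffP forallP) => [inc i j lt_ij|inc i].
  by have /forallP/(_ j)/implyP := inc i; apply.
by apply/forallP => j; apply/implyP/inc.
Qed.

Lemma strictly_increasing_inj r m (k : {ffun 'I_r -> 'I_m.+1}) :
  strictly_increasing k -> injective k.
Proof.
move=> /strictly_increasingP inc i j eq_k.
by apply: val_inj; case: (ltngtP i j) => // /inc; rewrite eq_k ltnn.
Qed.

Section CauchyBinet.
Variables (r m : nat).
Implicit Types (k : {ffun 'I_r -> 'I_m.+1}) (s : 'S_r).

Let ltI : rel 'I_m.+1 := fun x y => (x < y)%N.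

Let ltI_trans : transitive ltI.
Proof. by move=> y x z; apply: ltn_trans. Qed.

Let nth_codom_ord k (i : 'I_r) x : nth x [tuple k i | i < r] i = k i.
Proof. by rewrite -tnth_nth tnth_mktuple. Qed.

(** Sorted sequences have the existence and uniqueness properties that show
    that an injective map is, in one way, a strictly increasing map composed
    with a permutation. *)
Lemma strictly_increasing_sorted k :
  strictly_increasing k = sorted ltI [tuple k i | i < r].
Proof.
apply/strictly_increasingP/idP => [inc|srt i j lt_ij].
  case: r k inc => [|r'] k' inc; first by rewrite [tval _]size0nil // size_tuple.
  apply/(sortedP (k' ord0)) => t; rewrite size_tuple => lt_t.
  have lt_t' := ltnW lt_t.
  by rewrite -[t]/(val (Ordinal lt_t')) -[t.+1]/(val (Ordinal lt_t))
       -!tnth_nth !tnth_mktuple; apply: inc.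
have := sorted_ltn_nth (leT := ltI) ltI_trans (k i) srt.
move/(_ i j); rewrite !inE size_tuple !ltn_ord => /(_ isT isT lt_ij).
by rewrite /ltI !nth_codom_ord.
Qed.

Lemma injective_sort k : injective k ->
  exists2 k', strictly_increasing k' & exists s, k = [ffun i => k' (s i)].
Proof.
move=> k_inj; pose leI : rel 'I_m.+1 := fun x y => (x <= y)%N.
pose t := [tuple k i | i < r]; pose u := [tuple of sort leI t].
pose k' := [ffun i => tnth u i].
have ut : tval [tuple k' i | i < r] = u.
  by congr tval; apply: eq_from_tnth => i; rewrite tnth_mktuple ffunE.
exists k'.
  rewrite strictly_increasing_sorted ut.
  have -> : sorted ltI u = sorted ltn (map val u) by rewrite sorted_map.
  rewrite ltn_sorted_uniq_leq sorted_map.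
  apply/andP; split; last by apply: (sort_sorted (leT := leI)) => x y; apply: leq_total.
  rewrite map_inj_uniq; last exact: val_inj.
  by rewrite sort_uniq map_inj_uniq ?enum_uniq.
have /tuple_permP[s ts] : perm_eq t u by rewrite perm_sym /= perm_sort.
exists s; apply/ffunP => i; rewrite !ffunE.
have := congr1 (fun v => nth (k i) v i) ts.
by rewrite nth_codom_ord -tnth_nth tnth_mktuple.
Qed.

Lemma strictly_increasing_comp_eq k1 k2 s1 s2 :
  strictly_increasing k1 -> strictly_increasing k2 ->
  [ffun i => k1 (s1 i)] = [ffun i => k2 (s2 i)] -> k1 = k2 /\ s1 = s2.
Proof.
move=> inc1 inc2 /ffunP eq12.
have k12 : k1 = k2.
  have : tval [tuple k1 i | i < r] = [tuple k2 i | i < r].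
    apply: (irr_sorted_eq (leT := ltI)).
    - exact: ltI_trans.
    - by move=> x; apply: ltnn.
    - by rewrite -strictly_increasing_sorted.
    - by rewrite -strictly_increasing_sorted.
    have sub k3 k4 s3 s4 : [ffun i => k3 (s3 i)] =1 [ffun i => k4 (s4 i)] ->
        {subset [tuple k3 i | i < r] <= [tuple k4 i | i < r]}.
      move=> e x /tnthP[i ->]; rewrite tnth_mktuple.
      have := e ((s3^-1)%g i); rewrite !ffunE permKV => ->.
      by rewrite -[X in X \in _](tnth_mktuple (fun i => k4 i)) mem_tnth.
    by move=> x; apply/idP/idP;
      [exact: (sub _ _ _ _ eq12 x) | exact: (sub _ _ _ _ (fsym eq12) x)].
  move=> e; apply/ffunP => i.
  by have := congr1 (fun v => nth (k1 i) v i) e; rewrite !nth_codom_ord.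
split=> //; apply/permP => i; have := eq12 i; rewrite !ffunE k12.
exact: (strictly_increasing_inj inc2).
Qed.

Lemma sum_injective_increasing (V : nmodType)
    (h : {ffun 'I_r -> 'I_m.+1} -> V) :
  \sum_(k : {ffun 'I_r -> 'I_m.+1} | injectiveb k) h k =
  \sum_(k : {ffun 'I_r -> 'I_m.+1} | strictly_increasing k)
    \sum_(s : 'S_r) h [ffun i => k (s i)].
Proof.
rewrite pair_big /=.
rewrite [RHS](partition_big (fun p : {ffun 'I_r -> 'I_m.+1} * 'S_r =>
   [ffun i => p.1 (p.2 i)])
   (fun k : {ffun 'I_r -> 'I_m.+1} => injectiveb k)) /=; last first.
  move=> [k s]; rewrite andbT => /strictly_increasing_inj k_inj.
  by apply/injectiveP => i j; rewrite !ffunE => /k_inj/perm_inj.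
apply: eq_bigr => k /injectiveP/injective_sort[k' inc [s def_k]].
rewrite (big_pred1 (k', s)) /= -?def_k // => -[k1 s1] /=.
apply/andP/eqP => [[/andP[inc1 _] /eqP]|[-> ->]]; last by rewrite inc -def_k.
by rewrite def_k => /strictly_increasing_comp_eq[] // -> ->.
Qed.

(** Multilinearity expands the determinant over all maps [k]; the terms with
    [k] not injective have two equal rows, and the others are collected by the
    strictly increasing map with the same image. *)
Theorem cauchy_binet (F : comNzRingType) (A : 'M[F]_(r, m.+1))
    (B : 'M[F]_(m.+1, r)) :
  \det (A *m B) = \sum_(k : {ffun 'I_r -> 'I_m.+1} | strictly_increasing k)
    \det (colsub k A) * \det (rowsub k B).
Proof.
transitivity (\sum_(k : {ffun 'I_r -> 'I_m.+1})
    (\prod_i A i (k i)) * \det (rowsub k B)).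
  rewrite /determinant; under [RHS]eq_bigr do rewrite mulr_sumr.
  rewrite exchange_big /=; apply: eq_bigr => s _.
  under eq_bigr do rewrite mxE.
  rewrite bigA_distr_bigA mulr_sumr; apply: eq_bigr => k _.
  rewrite mulrCA; congr (_ * _); rewrite big_split; congr (_ * _).
  by apply: eq_bigr => i _; rewrite mxE.
rewrite (bigID (fun k : {ffun _} => injectiveb k)) /= [X in _ + X]big1 ?addr0.
  rewrite sum_injective_increasing; apply: eq_bigr => k _.
  rewrite {2}/determinant mulr_suml; apply: eq_bigr => s _.
  have -> : rowsub [ffun i => k (s i)] B = row_perm s (rowsub k B).
    by apply/matrixP => i j; rewrite !mxE ffunE.
  rewrite row_permE det_mulmx det_perm mulrA [_ * (-1) ^+ _]mulrC.
  by congr (_ * _ * _); apply: eq_bigr => i _; rewrite !mxE ffunE.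
move=> k /injectivePn[i [j ne_ij eq_k]].
rewrite (determinant_alternate ne_ij) ?mulr0 // => l.
by rewrite !mxE eq_k.
Qed.

End CauchyBinet.

(** * The multiple sum for generic parameters *)

Lemma prod_rev (F : comPzSemiRingType) n (f : nat -> F) :
  \prod_(i < n.+1) f i = \prod_(i < n.+1) f (n - i)%N.
Proof. by rewrite (reindex_inj rev_ord_inj) /=; apply: eq_bigr => i _; rewrite subSS. Qed.

Lemma prod_rev_lt (F : comPzSemiRingType) n (f : nat -> F) :
  \prod_(i < n) f i = \prod_(i < n) f (n - i.+1)%N.
Proof. by rewrite (reindex_inj rev_ord_inj). Qed.

Lemma prod_pairs_triangle (F : comPzSemiRingType) n (f : nat -> nat -> F) :
  \prod_(i < n.+1) \prod_(j < n.+1 | (i < j)%N) f i j =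
  \prod_(i < n.+1) \prod_(l < n - i) f i (n - l)%N.
Proof.
apply: eq_bigr => i _; rewrite (reindex_inj rev_ord_inj) /=.
rewrite (big_ord_widen n.+1 (fun l => f i (n - l)%N)) ?leqW ?leq_subr //.
by apply: eq_big => l; rewrite subSS // ltn_subRL ltn_subRL addnC.
Qed.

Section GenericSum.
Variables (F : fieldType) (q : F) (th : F -> F).
Hypotheses (q0 : q != 0) (thP : theta_like th).

Let th1 : th 1 = 0. Proof. by have [] := thP. Qed.
Let thV x : x != 0 -> th x^-1 = - x^-1 * th x.
Proof. by have [_ + _] := thP; apply. Qed.
Let weier := let: And3 _ _ w := thP in w.
Let qX0 n : q ^+ n != 0. Proof. by rewrite expf_neq0. Qed.

Let qB m n : (n <= m)%N -> q ^+ (m - n) = q ^+ m / q ^+ n.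
Proof. by move=> le_nm; rewrite expfB_cond // (negbTE q0). Qed.

Local Notation poch := (poch q th).
Local Notation vwp_term := (vwp_term q th).
Local Notation generic := (generic q th).

(** The factorial with descending exponents, which the second factors of the
    brackets with [y], [y q], [y q ^ 2], ... produce. *)
Definition plow (x : F) (n : nat) : F := \prod_(l < n) th (x / q ^+ l).

Lemma plowE x n : plow x n = poch (x * q / q ^+ n) n.
Proof.
rewrite /plow /poch (prod_rev_lt n (fun l => th (x / q ^+ l))).
apply: eq_bigr => i _; congr th.
by rewrite qB ?ltn_ord // exprS; fieldnz.
Qed.

Lemma plow_shift x n k :
  plow (x * q ^+ k) n * poch (x * q / q ^+ n) k = plow x n * poch (x * q) k.
Proof.
rewrite !plowE mulrC.
have -> : x * q ^+ k * q / q ^+ n = x * q / q ^+ n * q ^+ k by ring.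
rewrite [in X in _ = _ * X](_ : x * q = x * q / q ^+ n * q ^+ n); last by fieldnz.
by rewrite -!pochD addnC.
Qed.

Lemma poch_shift x n k :
  poch x k * poch (x * q ^+ k) n = poch x n * poch (x * q ^+ n) k.
Proof. by rewrite -!pochD addnC. Qed.

Lemma plow_div_poch x n m : (n <= m)%N -> generic x ->
  plow x n / poch (x * q / q ^+ n) m = (poch (x * q) (m - n))^-1.
Proof.
move=> le_nm gx.
have [gn gm] : poch (x * q / q ^+ n) n != 0 /\ poch (x * q) (m - n) != 0.
  split; first by apply: (generic_pochM (i := 1) (j := n) _ gx); rewrite expr1.
  by apply: (generic_pochM (i := 1) (j := 0) _ gx); rewrite expr1 expr0 divr1.
rewrite plowE -{1}(subnKC le_nm) pochD.
have -> : x * q / q ^+ n * q ^+ n = x * q by fieldnz.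
by rewrite invfM mulrA divff ?mul1r.
Qed.

(** The pairing of a vector [x] of the first kind with a vector [y] of the
    second kind. *)
Definition br (a x y : F) : F := th (x * y) * th (a * x / y).

Lemma prod_br a x y n : y != 0 ->
  \prod_(l < n) br a x (y * q ^+ l) = poch (x * y) n * plow (a * x / y) n.
Proof.
move=> y0; rewrite /br big_split /=; congr (_ * _); apply: eq_bigr => i _.
  by rewrite mulrA.
by congr th; fieldnz.
Qed.

Lemma vwp_ratio_shift a b k n : a != 0 -> b != 0 -> generic (a / b) ->
  poch b k / poch (a * q / b) k * \prod_(l < n) br a (q ^+ k) (b * q ^+ l) =
  poch b n * plow (a / b) n *
  (poch (b * q ^+ n) k / poch (a * q / (b * q ^+ n)) k).
Proof.
move=> a0 b0 gab; rewrite prod_br //.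
have E1 := poch_shift b n k; have E2 := plow_shift (a / b) n k.
have p1 : poch (a / b * q / q ^+ n) k != 0.
  by apply: (generic_pochM (i := 1) (j := n) _ gab).
have p2 : poch (a / b * q) k != 0.
  by apply: (generic_pochM (i := 1) (j := 0) _ gab); rewrite expr1 expr0 divr1.
have -> : a * q / (b * q ^+ n) = a / b * q / q ^+ n by fieldnz.
have -> : a * q / b = a / b * q by ring.
have -> : a * q ^+ k / b = a / b * q ^+ k by ring.
have -> : q ^+ k * b = b * q ^+ k by ring.
apply: (mulIf p1); apply: (mulIf p2).
transitivity ((poch b k * poch (b * q ^+ k) n) *
  (plow (a / b * q ^+ k) n * poch (a / b * q / q ^+ n) k)); first by fieldnz.
by rewrite E1 E2; fieldnz.
Qed.

Let qshift (b : F) (l : nat) := b * q ^+ l.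

(** Multiplication by brackets shifts the parameters of a very-well-poised
    term; this is why the determinants of brackets can be summed. *)
Lemma vwp_term_shift a b c d e m n1 n2 n3 n4 k :
  a != 0 -> b != 0 -> c != 0 -> d != 0 -> e != 0 ->
  generic (a / b) -> generic (a / c) -> generic (a / d) -> generic (a / e) ->
  vwp_term a b c d e m k *
  (\prod_(l < n1) br a (q ^+ k) (qshift b l) * \prod_(l < n2) br a (q ^+ k) (qshift c l)) *
  (\prod_(l < n3) br a (q ^+ k) (qshift d l) * \prod_(l < n4) br a (q ^+ k) (qshift e l)) =
  (poch b n1 * plow (a / b) n1 * (poch c n2 * plow (a / c) n2)) *
  (poch d n3 * plow (a / d) n3 * (poch e n4 * plow (a / e) n4)) *
  vwp_term a (b * q ^+ n1) (c * q ^+ n2) (d * q ^+ n3) (e * q ^+ n4) m k.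
Proof.
move=> a0 b0 c0 d0 e0 gb gc gd ge; rewrite /vwp_term.
have Eb := vwp_ratio_shift k n1 a0 b0 gb.
have Ec := vwp_ratio_shift k n2 a0 c0 gc.
have Ed := vwp_ratio_shift k n3 a0 d0 gd.
have Ee := vwp_ratio_shift k n4 a0 e0 ge.
rewrite /qshift; set Z := th (a * q ^+ (2 * k)) * poch a k * poch (q ^- m) k * q ^+ k /
  (th a * (poch q k * poch (a * q ^+ m.+1) k)).
pose G x n := \prod_(l < n) br a (q ^+ k) (x * q ^+ l).
pose H x := poch x k / poch (a * q / x) k.
have E x y z t : th (a * q ^+ (2 * k)) *
    (poch a k * poch x k * poch y k * poch z k * poch t k * poch (q ^- m) k) /
    (th a * (poch q k * poch (a * q / x) k * poch (a * q / y) k *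
     poch (a * q / z) k * poch (a * q / t) k * poch (a * q ^+ m.+1) k)) * q ^+ k =
    Z * (H x * H y * (H z * H t)).
  by rewrite /Z /H !invfM; ring.
rewrite !E.
transitivity (Z * ((H b * G b n1) * (H c * G c n2) * ((H d * G d n3) * (H e * G e n4)))).
  by rewrite /G; ring.
rewrite /H /G Eb Ec Ed Ee; ring.
Qed.

(** Up to scaling, the pairings of two vectors of the first kind and of two
    vectors of the second kind.  The factors [u] and [a / y] are those that
    Weierstrass' relation requires. *)
Definition pair_br (a x u : F) : F := u * (th (a * x * u) * th (x / u)).
Definition copair_br (a y v : F) : F := a / y * (th (y * v / a) * th (y / v)).

Lemma br_plucker a x u y v : a != 0 ->
  x != 0 -> u != 0 -> y != 0 -> v != 0 ->
  br a x y * br a u v - br a x v * br a u y = pair_br a x u * copair_br a y v.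
Proof.
move=> a0 x0 u0 y0 v0; rewrite /br weier // /pair_br /copair_br; ring.
Qed.

Lemma det_br_points a b c n m (k : 'I_n.+1 -> 'I_m.+1) :
  a != 0 -> b != 0 -> c != 0 -> generic c -> generic (a / c) ->
  \det (\matrix_(i < n.+1, j < n.+1)
     bracket_prod (br a) n (qshift b) (qshift c) (q ^+ k i) j) =
  \prod_(i < n.+1) \prod_(j < n.+1 | (i < j)%N)
     pair_br a (q ^+ k i) (q ^+ k j) *
  \prod_(i < n.+1) \prod_(l < n - i) copair_br a (qshift b l) (qshift c i).
Proof.
move=> a0 b0 c0 gc gac.
apply: (@det_bracket_prod _ _ _ (fun x => x != 0) (fun x => x != 0)
  (pair_br a) (br a) (copair_br a) _ n (fun i => q ^+ k i)) => // [x u y v|l|l|i l _].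
- exact: br_plucker.
- by rewrite /qshift; nonzero.
- by rewrite /qshift; nonzero.
rewrite /br /qshift mulf_neq0 //.
  by have := gc (k i + l)%N 0; rewrite exprD expr0 divr1; congr (th _ != 0); ring.
by have := gac (k i) l; congr (th _ != 0); fieldnz.
Qed.

(** The determinant left after summation.  The brackets whose
    power of [q] is between [n] and [m - 1] occur in all columns; the others form
    the columns of [det_bracket_prod], where now the [y i] index the rows. *)
Lemma det_poch_poch al y0 n m (y := fun i => y0 * q ^+ i) : (n <= m)%N ->
  al != 0 -> y0 != 0 -> generic y0 -> generic (al / y0) ->
  \det (\matrix_(i < n.+1, j < n.+1)
     \prod_(t < m) br al (q ^+ (j + t)) (y i)) =
  \prod_(i < n.+1) \prod_(t < m - n) br al (q ^+ (n + t)) (y i) *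
  \prod_(i < n.+1) \prod_(l < n - i)
     (copair_br al (y i) (y (n - l)%N) *
      pair_br al (q ^+ (n - l.+1)) (q ^+ (m + i))).
Proof.
move=> le_nm al0 y00 gy gay.
have yn0 i : y i != 0 by rewrite /y; nonzero.
pose QQ l := q ^+ (n - l.+1); pose RR l := q ^+ (m + l).
have -> : \matrix_(i < n.+1, j < n.+1) \prod_(t < m) br al (q ^+ (j + t)) (y i) =
  \matrix_(i, j) ((\prod_(t < m - n) br al (q ^+ (n + t)) (y i)) *
    (\matrix_(i, j) bracket_prod (fun y x => br al x y) n QQ RR (y i) j) i j * 1).
  apply/matrixP => i j; rewrite !mxE mulr1 /bracket_prod.
  have le_jn : (j <= n)%N by rewrite -ltnS.
  have -> : m = ((n - j) + (m - n) + j)%N by lia.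
  rewrite 2!big_split_ord /= mulrCA mulrA; congr (_ * _ * _).
  - rewrite (prod_rev_lt _ (fun l => br al (QQ l) (y i))); apply: eq_bigr => t _.
    by rewrite /QQ; congr (br _ (_ ^+ _) _); have := ltn_ord t; lia.
  - have -> : (n - j + (m - n) + j - n = m - n)%N by lia.
    by apply: eq_bigr => t _; congr (br _ (_ ^+ _) _); lia.
  apply: eq_bigr => t _; rewrite /RR; congr (br _ (_ ^+ _) _); lia.
rewrite (det_scale _ _ (fun=> 1)) big1_eq mulr1; congr (_ * _).
rewrite (@det_bracket_prod _ _ _ (fun x => x != 0) (fun x => x != 0)
  (copair_br al) _ (pair_br al) _ n (fun i => y i)) //.
- rewrite (prod_pairs_triangle n (fun i j => copair_br al (y i) (y j))) -big_split.
  by apply: eq_bigr => i _; rewrite -big_split.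
- move=> x u z v x0 u0 z0 v0; rewrite [RHS]mulrC -br_plucker //; ring.
- by move=> l; apply: qX0.
- by move=> l; apply: qX0.
move=> i l _; rewrite /br /RR mulf_neq0 //.
  by have := gy (m + l + i)%N 0; rewrite !exprD expr0 divr1 /y; congr (th _ != 0); ring.
by have := gay (m + l)%N i; rewrite /y; congr (th _ != 0); fieldnz.
Qed.

(** Allows the shift to be exhibited only up to field equality. *)
Lemma generic_transport x y i j : generic x -> y = x * q ^+ i / q ^+ j -> generic y.
Proof. by move=> gx ->; apply: genericM. Qed.

Lemma plow_flip x n : x != 0 ->
  plow x n = \prod_(l < n) (- (x / q ^+ l)) * poch x^-1 n.
Proof.
move=> x0; rewrite /plow /poch -big_split; apply: eq_bigr => l _ /=.
have -> : x / q ^+ l = (x^-1 * q ^+ l)^-1 by fieldnz.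
rewrite thV; [|by nonzero]; fieldnz.
Qed.

(** The balancing condition of the shifted parameters is independent of [i] and
    [j], so every entry is a Frenkel-Turaev sum.  The value is arranged as a
    function of [i], a product of brackets, and a function of [j]. *)
Lemma vwp_sum_entry a b c d e m n i j :
  e = a ^+ 2 * q ^+ m.+1 / (b * c * d * q ^+ (2 * n)) ->
  (n <= m)%N -> (i <= n)%N -> (j <= n)%N ->
  a != 0 -> b != 0 -> c != 0 -> d != 0 ->
  generic a -> generic (a / b) -> generic (a / c) -> generic (a / d) ->
  generic (b * c * d / a) ->
  (forall i, (0 < i <= m)%N -> th (q ^+ i) != 0) ->
  \sum_(k < m.+1) vwp_term a b c d e m k *
     bracket_prod (br a) n (qshift b) (qshift c) (q ^+ k) i *
     bracket_prod (br a) n (qshift d) (qshift e) (q ^+ k) j =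
  (poch b (n - i) * poch c i /
     (poch (a * q / b) (m - (n - i)) * poch (a * q / c) (m - i)) *
   (poch (a * q) m * poch (a * q / (b * c * q ^+ n)) m)) *
  \prod_(t < m) br (a ^+ 2 * q ^+ 2 / (q ^+ (3 * n) * b * c * d ^+ 2))
     (q ^+ (j + t)) (a * q / (b * d * q ^+ (2 * n)) * q ^+ i) *
  (poch d (n - j) * poch e j * \prod_(l < j) (- (a / (e * q ^+ l))) /
     (poch (a * q / d) (m - (n - j)) *
      poch (a * q ^+ j.+1 / (b * c * d * q ^+ (2 * n))) (m - j))).
Proof.
move=> def_e le_nm le_in le_jn a0 b0 c0 d0 ga gb gc gd ge gq.
have e0 : e != 0 by rewrite def_e; nonzero.
have gae : generic (a / e).
  by apply: (generic_transport (i := 2 * n) (j := m.+1) ge); rewrite def_e; fieldnz.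
rewrite /bracket_prod; under eq_bigr do rewrite vwp_term_shift //.
rewrite -mulr_sumr.
pose b' := b * q ^+ (n - i); pose c' := c * q ^+ i; pose d' := d * q ^+ (n - j).
have qn : q ^+ (2 * n) = q ^+ n * q ^+ n by rewrite mul2n -addnn exprD.
have qn3 : q ^+ (3 * n) = q ^+ n * q ^+ n * q ^+ n by rewrite !mulSn addn0 !exprD mulrA.
have -> : e * q ^+ j = a ^+ 2 * q ^+ m.+1 / (b' * c' * d').
  by rewrite def_e /b' /c' /d' !qB // qn; fieldnz.
rewrite frenkel_turaev //; first last.
- apply: (generic_transport (i := n + n) (j := j) ge).
  by rewrite /b' /c' /d' !qB // exprD; fieldnz.
- apply: (generic_transport (i := j) (j := n) gd).
  by rewrite /d' !qB //; fieldnz.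
- apply: (generic_transport (i := 0) (j := i) gc).
  by rewrite /c'; fieldnz.
- apply: (generic_transport (i := i) (j := n) gb).
  by rewrite /b' !qB //; fieldnz.
- by rewrite /d'; nonzero.
- by rewrite /c'; nonzero.
- by rewrite /b'; nonzero.
have -> : a * q / (b' * c') = a * q / (b * c * q ^+ n).
  by rewrite /b' /c' qB //; fieldnz.
have -> : \prod_(t < m) br (a ^+ 2 * q ^+ 2 / (q ^+ (3 * n) * b * c * d ^+ 2))
     (q ^+ (j + t)) (a * q / (b * d * q ^+ (2 * n)) * q ^+ i) =
     poch (a * q / (b' * d')) m * poch (a * q / (c' * d')) m.
  rewrite /poch -big_split; apply: eq_bigr => t _ /=.
  rewrite /br; congr (th _ * th _); rewrite exprD /b' /c' /d' !qB // ?qn ?qn3; fieldnz.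
have pd x y l : x != 0 -> generic (a / x) -> (l <= m)%N -> y = x * q ^+ l ->
    plow (a / x) l / poch (a * q / y) m = (poch (a * q / x) (m - l))^-1.
  move=> x0 gx le_l ->.
  have -> : a * q / x = a / x * q by ring.
  by rewrite -(plow_div_poch le_l gx); congr (_ / poch _ _); fieldnz.
have Eb := pd b b' (n - i)%N b0 gb (leq_trans (leq_subr _ _) le_nm) erefl.
have Ec := pd c c' i c0 gc (leq_trans le_in le_nm) erefl.
have Ed := pd d d' (n - j)%N d0 gd (leq_trans (leq_subr _ _) le_nm) erefl.
have gx : generic (a / (b * c * d)).
  have -> : a / (b * c * d) = (b * c * d / a)^-1 by fieldnz.
  by apply: genericV => //; nonzero.
have Ee : plow (a / e) j / poch (a * q / (b' * c' * d')) m =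
  \prod_(l < j) (- (a / (e * q ^+ l))) /
  poch (a * q ^+ j.+1 / (b * c * d * q ^+ (2 * n))) (m - j).
  rewrite plow_flip; [|by nonzero].
  have -> : a * q / (b' * c' * d') = a * q ^+ j.+1 / (b * c * d * q ^+ (2 * n)).
    by rewrite /b' /c' /d' !qB // qn exprS; fieldnz.
  have {1}-> : m = (m - j + j)%N by rewrite subnK // (leq_trans le_jn).
  rewrite pochD.
  have -> : a * q ^+ j.+1 / (b * c * d * q ^+ (2 * n)) * q ^+ (m - j) = (a / e)^-1.
    by rewrite def_e !exprS qB ?(leq_trans le_jn) // qn; fieldnz.
  have p1 : poch (a / e)^-1 j != 0.
    by apply: generic_poch; apply: genericV => //; nonzero.
  have p2 : poch (a * q ^+ j.+1 / (b * c * d * q ^+ (2 * n))) (m - j) != 0.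
    by apply: (generic_pochM (i := j.+1) (j := 2 * n) _ gx); fieldnz.
  under eq_bigr do rewrite -mulrA -invfM.
  fieldnz.
rewrite [X in _ * (_ / X)](_ : _ =
    poch (a * q / b') m * poch (a * q / c') m * poch (a * q / d') m *
    poch (a * q / (b' * c' * d')) m) //.
pose Z := poch (a * q / (b' * d')) m * poch (a * q / (c' * d')) m *
   (poch (a * q) m * poch (a * q / (b * c * q ^+ n)) m).
transitivity (Z * poch b (n - i) * poch c i * poch d (n - j) * poch e j *
   (plow (a / b) (n - i) / poch (a * q / b') m) *
   (plow (a / c) i / poch (a * q / c') m) *
   (plow (a / d) (n - j) / poch (a * q / d') m) *
   (plow (a / e) j / poch (a * q / (b' * c' * d')) m)).
  by rewrite /Z !invfM; ring.
rewrite Eb Ec Ed Ee /Z !invfM; ring.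
Qed.

Lemma det_entry_sums a b c d e m n :
  a != 0 -> b != 0 -> c != 0 -> d != 0 -> e != 0 ->
  generic c -> generic (a / c) -> generic e -> generic (a / e) ->
  (\sum_(k : {ffun 'I_n.+1 -> 'I_m.+1} | strictly_increasing k)
     (\prod_(i < n.+1) \prod_(j < n.+1 | (i < j)%N)
        pair_br a (q ^+ k i) (q ^+ k j)) ^+ 2 *
     \prod_(i < n.+1) vwp_term a b c d e m (k i)) *
  ((\prod_(i < n.+1) \prod_(l < n - i) copair_br a (qshift b l) (qshift c i)) *
   (\prod_(i < n.+1) \prod_(l < n - i) copair_br a (qshift d l) (qshift e i))) =
  \det (\matrix_(i < n.+1, j < n.+1)
    \sum_(k < m.+1) vwp_term a b c d e m k *
     bracket_prod (br a) n (qshift b) (qshift c) (q ^+ k) i *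
     bracket_prod (br a) n (qshift d) (qshift e) (q ^+ k) j).
Proof.
move=> a0 b0 c0 d0 e0 gc gac ge gae.
pose A := \matrix_(i < n.+1, k < m.+1)
   (vwp_term a b c d e m k * bracket_prod (br a) n (qshift b) (qshift c) (q ^+ k) i).
pose B := \matrix_(k < m.+1, j < n.+1)
   bracket_prod (br a) n (qshift d) (qshift e) (q ^+ k) j.
rewrite [X in _ = \det X](_ : _ = A *m B); last first.
  by apply/matrixP => i j; rewrite !mxE; apply: eq_bigr => k _; rewrite !mxE.
rewrite cauchy_binet mulr_suml; apply: eq_bigr => k _.
have -> : \det (colsub k A) = \prod_(i < n.+1) vwp_term a b c d e m (k i) *
    \det (\matrix_(i < n.+1, j < n.+1)
      bracket_prod (br a) n (qshift b) (qshift c) (q ^+ k i) j).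
  rewrite -det_tr; set G := \matrix_(i, j) bracket_prod _ _ _ _ _ _.
  have := det_scale G (fun i => vwp_term a b c d e m (k i)) (fun=> 1).
  rewrite big1_eq mulr1 => <-; congr (\det _).
  by apply/matrixP => i j; rewrite !mxE mulr1.
have -> : rowsub k B = \matrix_(i < n.+1, j < n.+1)
      bracket_prod (br a) n (qshift d) (qshift e) (q ^+ k i) j.
  by apply/matrixP => i j; rewrite !mxE.
rewrite !det_br_points //; ring.
Qed.

(** Products over the pairs [i + l < n], the common index set to which all the
    products over pairs are brought. *)
Definition tri_prod (n : nat) (f : nat -> nat -> F) : F :=
  \prod_(i < n.+1) \prod_(l < n - i) f i l.

Lemma triM n f g : tri_prod n f * tri_prod n g = tri_prod n (fun i l => f i l * g i l).
Proof. by rewrite /tri_prod -big_split; apply: eq_bigr => i _; rewrite -big_split. Qed.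

Lemma tri_row_rev n f : tri_prod n f = tri_prod n (fun i l => f i (n - i - l.+1)%N).
Proof. by apply: eq_bigr => i _; rewrite (prod_rev_lt _ (f i)). Qed.

Lemma eq_tri n f g : (forall i l, (l < n - i)%N -> f i l = g i l) ->
  tri_prod n f = tri_prod n g.
Proof. by move=> e; apply: eq_bigr => i _; apply: eq_bigr => l _; apply: e. Qed.

Lemma prod_rows_tri n (g : nat -> nat -> F) :
  \prod_(i < n.+1) \prod_(l < i) g i l = tri_prod n (fun i l => g (n - i)%N l).
Proof. by rewrite (prod_rev n (fun i => \prod_(l < i) g i l)). Qed.

(** Splits the range of exponents of each factorial into the part wanted on
    the right-hand side and the parts before and after it; over all rows the
    latter fill two triangles. *)
Lemma poch_split_tri x n m : (n <= m)%N ->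
  \prod_(i < n.+1) poch (x / q ^+ n) m =
  \prod_(i < n.+1) poch (x / q ^+ i) (m - n) *
  tri_prod n (fun i l => th (x / q ^+ (i + l).+1) *
                    th (x / q ^+ n * q ^+ (m - n + i + l))).
Proof.
move=> le_nm; rewrite -triM.
have -> : tri_prod n (fun i l => th (x / q ^+ (i + l).+1)) =
    \prod_(i < n.+1) poch (x / q ^+ n) (n - i).
  rewrite tri_row_rev; apply: eq_bigr => i _; apply: eq_bigr => l _.
  congr th; rewrite -mulrA; congr (_ * _).
  have lt_l := ltn_ord l.
  have -> : (i + (n - i - l.+1)).+1 = (n - l)%N by lia.
  rewrite qB; [by fieldnz | lia].

have -> : tri_prod n (fun i l => th (x / q ^+ n * q ^+ (m - n + i + l))) =
    \prod_(i < n.+1) poch (x / q ^+ i * q ^+ (m - n)) i.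
  rewrite (prod_rev n (fun i => poch (x / q ^+ i * q ^+ (m - n)) i)).
  apply: eq_bigr => i _; apply: eq_bigr => l _.
  have le_in : (i <= n)%N by rewrite -ltnS.
  by congr th; rewrite [q ^+ (n - i)]qB // !exprD; fieldnz.
rewrite -!big_split; apply: eq_bigr => i _ /=.
have le_in : (i <= n)%N by rewrite -ltnS.
have {1}-> : m = ((n - i) + (m - n) + i)%N by lia.
rewrite !pochD mulrCA mulrA; congr (_ * _ * _).
  by congr poch; rewrite qB //; fieldnz.
congr poch; rewrite exprD [q ^+ (n - i)]qB //; fieldnz.
Qed.

Lemma prod_poch_qX n : \prod_(i < n.+1) poch q i =
  tri_prod n (fun i l => th (q ^+ n / q ^+ (i + l))).
Proof.
rewrite tri_row_rev (prod_rev n (poch q)).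
apply: eq_bigr => i _; apply: eq_bigr => l _; congr th.
have lt_l := ltn_ord l; rewrite -exprS -qB; last by lia.
by congr (_ ^+ _); lia.
Qed.

Lemma prod_poch_q_const n m : (n <= m)%N ->
  \prod_(i < n.+1) poch q m = \prod_(i < n.+1) poch q (m - i) *
    tri_prod n (fun i l => th (q ^+ (m - n + i + l).+1)).
Proof.
move=> le_nm; rewrite (prod_rev n (fun i => poch q (m - i))) -big_split.
apply: eq_bigr => i _ /=.
have le_in : (i <= n)%N by rewrite -ltnS.
have {1}-> : m = (m - (n - i) + (n - i))%N by lia.
rewrite pochD; congr (_ * _); apply: eq_bigr => l _.
by rewrite -exprS -exprD; congr (th (q ^+ _)); lia.
Qed.

(** After division by the two constants coming from [det_bracket_prod], both
    sides are products over rows times products over the triangle.  The rows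
    agree, and the triangles agree in each factor up to a monomial. *)
Theorem generic_sum a b c d e m n :
  e = a ^+ 2 * q ^+ m.+1 / (b * c * d * q ^+ (2 * n)) ->
  (n <= m)%N ->
  a != 0 -> b != 0 -> c != 0 -> d != 0 ->
  generic a -> generic c -> generic e ->
  generic (a / b) -> generic (a / c) -> generic (a / d) ->
  generic (b * c * d / a) ->
  generic (b * c / a) -> generic (b / c) -> generic (d / e) ->
  generic (a / (b * d)) -> generic (a / (c * d)) ->
  (forall i, (0 < i <= m)%N -> th (q ^+ i) != 0) ->
  \sum_(k : {ffun 'I_n.+1 -> 'I_m.+1} | strictly_increasing k)
     (\prod_(i < n.+1) \prod_(j < n.+1 | (i < j)%N)
        pair_br a (q ^+ k i) (q ^+ k j)) ^+ 2 *
     \prod_(i < n.+1) vwp_term a b c d e m (k i) =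
  \prod_(i < n.+1)
   (poch q i * poch b i * poch c i * poch d i * poch e i *
    (poch q m * poch (a * q) m *
     (poch (a * q / (b * c) / q ^+ i) (m - n) *
      poch (a * q / (b * d) / q ^+ i) (m - n) *
      poch (a * q / (c * d) / q ^+ i) (m - n))) /
    (poch q (m - i) * poch (a * q / b) (m - i) * poch (a * q / c) (m - i) *
     poch (a * q / d) (m - i) *
     poch (a * q ^+ i.+1 / (b * c * d * q ^+ (2 * n))) (m - i))) *
  tri_prod n (fun i l => a / (b * c * d) * q ^+ i / (q ^+ (2 * l) * q ^+ n)).
Proof.
move=> def_e le_nm a0 b0 c0 d0 ga gc ge gab gac gad gbcda gbca gbc gde gabd gacd gq.
have e0 : e != 0 by rewrite def_e; nonzero.
have gae : generic (a / e).
  by apply: (generic_transport (i := 2 * n) (j := m.+1) gbcda); rewrite def_e; fieldnz.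
have qn : q ^+ (2 * n) = q ^+ n * q ^+ n by rewrite mul2n -addnn exprD.
have qn3 : q ^+ (3 * n) = q ^+ n * q ^+ n * q ^+ n by rewrite !mulSn addn0 !exprD mulrA.
have gabc : generic (a / (b * c)).
  by rewrite -[a / _]invf_div; apply: genericV => //; nonzero.
have K1 : \prod_(i < n.+1) \prod_(l < n - i) copair_br a (qshift b l) (qshift c i) != 0.
  apply/prodf_neq0 => i _; apply/prodf_neq0 => l _.
  rewrite /copair_br /qshift; nonzero.
    by have := gbca (i + l)%N 0; rewrite exprD expr0 divr1; congr (th _ != 0); ring.
  by have := gbc l i; congr (th _ != 0); fieldnz.
have K2 : \prod_(i < n.+1) \prod_(l < n - i) copair_br a (qshift d l) (qshift e i) != 0.
  apply/prodf_neq0 => i _; apply/prodf_neq0 => l _.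
  rewrite /copair_br /qshift; nonzero.
    have := gabc (m.+1 + i + l)%N (n + n)%N; rewrite !exprD; congr (th _ != 0).
    by rewrite def_e exprS qn; fieldnz.
  by have := gde l i; congr (th _ != 0); fieldnz.
apply: (mulIf (mulf_neq0 K1 K2)); rewrite det_entry_sums //.
under eq_mx => i j do rewrite (vwp_sum_entry def_e) ?(leq_ord i) ?(leq_ord j) //.

pose al := a ^+ 2 * q ^+ 2 / (q ^+ (3 * n) * b * c * d ^+ 2).
pose y0 := a * q / (b * d * q ^+ (2 * n)).
pose M := \matrix_(i < n.+1, j < n.+1)
  \prod_(t < m) br al (q ^+ (j + t)) (y0 * q ^+ i).
pose U (i : 'I_n.+1) := poch b (n - i) * poch c i /
     (poch (a * q / b) (m - (n - i)) * poch (a * q / c) (m - i)) *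
   (poch (a * q) m * poch (a * q / (b * c * q ^+ n)) m).
pose V (j : 'I_n.+1) := poch d (n - j) * poch e j *
   \prod_(l < j) (- (a / (e * q ^+ l))) /
     (poch (a * q / d) (m - (n - j)) *
      poch (a * q ^+ j.+1 / (b * c * d * q ^+ (2 * n))) (m - j)).
rewrite [X in \det X](_ : _ = \matrix_(i, j) (U i * M i j * V j)); last first.
  by apply/matrixP => i j; rewrite !mxE.
have al0 : al != 0 by rewrite /al; nonzero.
have y00 : y0 != 0 by rewrite /y0; nonzero.
rewrite det_scale det_poch_poch //; first last.
- by apply: (generic_transport (i := 1) (j := n) gacd); rewrite /al /y0 qn qn3 expr1; fieldnz.
- by apply: (generic_transport (i := 1) (j := n + n) gabd); rewrite /y0 qn exprD expr1; fieldnz.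
rewrite /U /V; clear U V M.
have -> : \prod_(i < n.+1) \prod_(t < m - n) br al (q ^+ (n + t)) (y0 * q ^+ i) =
   \prod_(i < n.+1) poch (a * q / (b * d) / q ^+ i) (m - n) *
   \prod_(i < n.+1) poch (a * q / (c * d) / q ^+ i) (m - n).
  rewrite (prod_rev n (fun i => poch (a * q / (b * d) / q ^+ i) (m - n))).
  rewrite -big_split; apply: eq_bigr => i _ /=.
  have le_in : (i <= n)%N by rewrite -ltnS.
  rewrite -big_split; apply: eq_bigr => t _ /=.
  rewrite /br /al /y0; congr (th _ * th _); rewrite exprD.
    by rewrite qn qB //; fieldnz.
  by rewrite qn qn3; fieldnz.
rewrite !(big_split, prodf_div) /=.
rewrite -!(prod_rev n (poch _)).
rewrite !prodfV !big_split /=.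
rewrite -(prod_rev n (fun i => poch (a * q / b) (m - i))).
rewrite -(prod_rev n (fun i => poch (a * q / d) (m - i))).
have -> : \prod_(i < n.+1) poch (a * q / (b * c * q ^+ n)) m =
          \prod_(i < n.+1) poch (a * q / (b * c) / q ^+ n) m.
  by apply: eq_bigr => i _; congr poch; fieldnz.
rewrite poch_split_tri //.
rewrite (prod_poch_qX n) (prod_poch_q_const le_nm).
rewrite (prod_rows_tri n (fun _ l => - (a / (e * q ^+ l)))).
set T1 := tri_prod n _.
set T2 := \prod_(i < n.+1) \prod_(l < n - i) _.
set T3 := tri_prod n _.
set T4 := tri_prod n _.
set T5 := tri_prod n _.
set T6 := tri_prod n _.
set T7 := \prod_(i < n.+1) \prod_(l < n - i) _.
set T8 := \prod_(i < n.+1) \prod_(l < n - i) _.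
have pQ : \prod_(i < n.+1) poch q (m - i) != 0.
  apply/prodf_neq0 => i _; apply/prodf_neq0 => l _; rewrite -exprS gq //=.
  by have := ltn_ord l; lia.
(* The comparison inside the triangle: each theta value of the left-hand side
   is that of an inverse argument or equal to one on the right. *)
have T : T1 * T2 * T3 = T4 * T5 * T6 * (T7 * T8).
  rewrite -[T2]/(tri_prod n (fun i l =>
    copair_br al (y0 * q ^+ i) (y0 * q ^+ (n - l)) *
      pair_br al (q ^+ (n - l.+1)) (q ^+ (m + i)))).
  rewrite -[T7]/(tri_prod n (fun i l => copair_br a (qshift b l) (qshift c i))).
  rewrite -[T8]/(tri_prod n (fun i l => copair_br a (qshift d l) (qshift e i))).
  rewrite !triM; apply: eq_tri => i l lt_l.
  have le_in : (i <= n)%N by move: (leq_trans (ltn0Sn l) lt_l); rewrite subn_gt0 => /ltnW.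
  have lt_ln : (l < n)%N := leq_trans lt_l (leq_subr _ _).
  have qm : q ^+ (m - n + i + l).+1 = q ^+ m * q ^+ i * q ^+ l * q / q ^+ n.
    by rewrite exprSr !exprD qB //; fieldnz.
  have V1 : th (a * q / (b * c) / q ^+ (i + l).+1) =
      - (qshift b l * qshift c i / a)^-1 * th (qshift b l * qshift c i / a).
    rewrite -thV; last by rewrite /qshift; nonzero.
    by congr th; rewrite /qshift exprSr exprD; fieldnz.
  have V2 : th (y0 * q ^+ i * (y0 * q ^+ (n - l)) / al) =
      - (qshift b l / qshift c i)^-1 * th (qshift b l / qshift c i).
    rewrite -thV; last by rewrite /qshift; nonzero.
    by congr th; rewrite /qshift /y0 /al qn qn3 qB ?(ltnW lt_ln) //; fieldnz.
  have V3 : th (y0 * q ^+ i / (y0 * q ^+ (n - l))) =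
      - (q ^+ n / q ^+ (i + l))^-1 * th (q ^+ n / q ^+ (i + l)).
    rewrite -thV; last by nonzero.
    by congr th; rewrite qB ?(ltnW lt_ln) // exprD; fieldnz.
  have V4 : th (al * q ^+ (n - l.+1) * q ^+ (m + i)) =
      - (qshift d l / qshift e i)^-1 * th (qshift d l / qshift e i).
    rewrite -thV; last by rewrite /qshift; nonzero.
    congr th; rewrite /qshift def_e /al qn qn3 qB // exprD !(exprS q l) (exprS q m).
    by fieldnz.
  have V5 : th (q ^+ (n - l.+1) / q ^+ (m + i)) =
      - (q ^+ (m - n + i + l).+1)^-1 * th (q ^+ (m - n + i + l).+1).
    rewrite -thV; last by nonzero.
    by congr th; rewrite qm qB // exprD (exprS q l); fieldnz.
  have V6 : th (a * q / (b * c) / q ^+ n * q ^+ (m - n + i + l)) =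
      th (qshift d l * qshift e i / a).
    congr th; rewrite /qshift def_e qn !exprD qB // (exprS q m); fieldnz.
  rewrite /copair_br /pair_br V1 V2 V3 V4 V5 V6 qm.
  move: (th _) (th _) (th _) (th _) (th _) (th _) => w1 w2 w3 w4 w5 w6.
  rewrite /qshift /y0 /al def_e qn qn3 mul2n -addnn !exprD (exprS q m); fieldnz.
have gpoch x y : generic x -> y = x * q ->
    \prod_(i < n.+1) poch y (m - i) != 0.
  move=> gx ->; apply/prodf_neq0 => i _.
  by apply: (generic_pochM (i := 1) (j := 0) _ gx); rewrite expr1 expr0 divr1.
have pB : \prod_(i < n.+1) poch (a * q / b) (m - i) != 0.
  by apply: gpoch gab _; ring.
have pC : \prod_(i < n.+1) poch (a * q / c) (m - i) != 0.
  by apply: gpoch gac _; ring.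
have pD : \prod_(i < n.+1) poch (a * q / d) (m - i) != 0.
  by apply: gpoch gad _; ring.
have pE : \prod_(i < n.+1)
    poch (a * q ^+ i.+1 / (b * c * d * q ^+ (2 * n))) (m - i) != 0.
  have gx : generic (a / (b * c * d)).
    by rewrite -[a / _]invf_div; apply: genericV => //; nonzero.
  apply/prodf_neq0 => i _.
  by apply: (generic_pochM (i := i.+1) (j := 2 * n) _ gx); fieldnz.
move: (\prod_(i < n.+1) poch q (m - i)) pQ => xQ pQ.
move: (\prod_(i < n.+1) poch (a * q / b) (m - i)) pB => xB pB.
move: (\prod_(i < n.+1) poch (a * q / c) (m - i)) pC => xC pC.
move: (\prod_(i < n.+1) poch (a * q / d) (m - i)) pD => xD pD.
move: (\prod_(i < n.+1) poch (a * q ^+ i.+1 / _) (m - i)) pE => xE pE.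
clearbody T1 T2 T3 T4 T5 T6 T7 T8.
move: (\prod_(i < n.+1) poch b i) (\prod_(i < n.+1) poch c i)
  (\prod_(i < n.+1) poch d i) (\prod_(i < n.+1) poch e i)
  (\prod_(i < n.+1) poch (a * q) m)
  (\prod_(i < n.+1) poch (a * q / (b * c) / _) (m - n))
  (\prod_(i < n.+1) poch (a * q / (b * d) / _) (m - n))
  (\prod_(i < n.+1) poch (a * q / (c * d) / _) (m - n))
  => x1 x2 x3 x4 x5 x6 x7 x8.
transitivity (x1 * x2 * x3 * x4 * x5 * x6 * x7 * x8 / (xB * xC * xD * xE) *
   (T1 * T2 * T3)); first by fieldnz.
by rewrite T; fieldnz.
Qed.

End GenericSum.

Lemma sum_ord_bin n : (\sum_(i < n) i = 'C(n, 2))%N.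
Proof. by rewrite -bin2_sum big_mkord. Qed.

Lemma tri_card n : (\sum_(i < n.+1) (n - i) = 'C(n.+1, 2))%N.
Proof.
rewrite -sum_ord_bin [RHS](reindex_inj rev_ord_inj) /=.
by apply: eq_bigr => i _; rewrite subSS.
Qed.

Lemma tri_sum_col n : (\sum_(i < n.+1) \sum_(l < n - i) l = 'C(n.+1, 3))%N.
Proof.
under eq_bigr do rewrite sum_ord_bin.
rewrite (reindex_inj rev_ord_inj) /=.
rewrite (eq_bigr (fun i : 'I_n.+1 => 'C(i, 2))) => [|i _]; last first.
  by rewrite subSS subKn // -ltnS.
elim: n => [|n IHn]; first by rewrite big_ord_recl big_ord0.
by rewrite big_ord_recr [RHS]binS -IHn.
Qed.

Lemma tri_sum_row n : (\sum_(i < n.+1) \sum_(l < n - i) i = 'C(n.+1, 3))%N.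
Proof.
under eq_bigr do rewrite sum_nat_const card_ord.
elim: n => [|n IHn]; first by rewrite big_ord_recl big_ord0.
rewrite big_ord_recr /= subnn mul0n addn0 binS -IHn addnC -sum_ord_bin.
by rewrite -big_split; apply: eq_bigr => i _ /=; rewrite subSn ?mulSn ?leq_ord.
Qed.

Section TriangleMonomial.
Variables (F : fieldType) (q : F).
Hypothesis q0 : q != 0.

(** Over the triangle both indices sum to [binomial (n + 1) 3], and [n] sums to
    [n * binomial (n + 1) 2], which is
    [3 * binomial (n + 1) 3 + binomial (n + 1) 2]. *)
Lemma tri_monomial n X :
  tri_prod n (fun i l => X * q ^+ i / (q ^+ (2 * l) * q ^+ n)) =
  q ^- (4 * 'C(n.+1, 3)) * (X / q) ^+ 'C(n.+1, 2).
Proof.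
have tri_const (Y : F) : tri_prod n (fun i l => Y) = Y ^+ 'C(n.+1, 2).
  rewrite -tri_card expr_sum; apply: eq_bigr => i _.
  by rewrite prodr_const card_ord.
have tri_exp (f : nat -> nat -> nat) : tri_prod n (fun i l => q ^+ f i l) =
    q ^+ (\sum_(i < n.+1) \sum_(l < n - i) f i l)%N.
  by rewrite expr_sum; apply: eq_bigr => i _; rewrite expr_sum.
have T0 : tri_prod n (fun i l => q ^+ (2 * l)) != 0 by rewrite tri_exp expf_neq0.
have T1 : tri_prod n (fun i l => X * q ^+ i / (q ^+ (2 * l) * q ^+ n)) *
    tri_prod n (fun i l => q ^+ (2 * l)) =
    tri_prod n (fun i l => X / q ^+ n) * tri_prod n (fun i l => q ^+ i).
  by rewrite !triM; apply: eq_tri => i l _; fieldnz.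
apply: (mulIf T0); rewrite T1 tri_const !tri_exp tri_sum_row.
under eq_bigr do rewrite -big_distrr /=.
rewrite -big_distrr /= tri_sum_col.
have bin_rel : (n * 'C(n.+1, 2) = 3 * 'C(n.+1, 3) + 'C(n.+1, 2))%N.
  have := mul_bin_left n.+1 2; case: n {T0 T1 tri_const tri_exp} => // n.
  by rewrite subSS /=; lia.
rewrite !exprMn !exprVn -exprM bin_rel exprD.
have -> : (4 * 'C(n.+1, 3) = 'C(n.+1, 3) + 3 * 'C(n.+1, 3))%N by lia.
have -> : (2 * 'C(n.+1, 3) = 'C(n.+1, 3) + 'C(n.+1, 3))%N by lia.
by rewrite !exprD; fieldnz.
Qed.

End TriangleMonomial.

Section MultipleSum.
Variables (F : fieldType) (q : F) (th : F -> F).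
Local Notation pch := (poch q th).
Local Notation gen := (generic q th).

Definition multi_sum (a b c d e : F) (n m : nat) : F :=
  \sum_(k : {ffun 'I_n.+1 -> 'I_m.+1} | strictly_increasing k)
     (\prod_(i < n.+1) \prod_(j < n.+1 | (i < j)%N)
        pair_br th a (q ^+ k i) (q ^+ k j)) ^+ 2 *
     \prod_(i < n.+1) vwp_term q th a b c d e m (k i).

Definition multi_closed (a b c d e : F) (n m : nat) : F :=
  \prod_(i < n.+1)
   (pch q i * pch b i * pch c i * pch d i * pch e i *
    (pch q m * pch (a * q) m *
     (pch (a * q / (b * c) / q ^+ i) (m - n) *
      pch (a * q / (b * d) / q ^+ i) (m - n) *
      pch (a * q / (c * d) / q ^+ i) (m - n))) /
    (pch q (m - i) * pch (a * q / b) (m - i) * pch (a * q / c) (m - i) *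
     pch (a * q / d) (m - i) *
     pch (a * q ^+ i.+1 / (b * c * d * q ^+ (2 * n))) (m - i))) *
  (q ^- (4 * 'C(n.+1, 3)) * (a / (b * c * d) / q) ^+ 'C(n.+1, 2)).

Lemma multi_sum_generic a b c d e m n : q != 0 -> theta_like th ->
  e = a ^+ 2 * q ^+ m.+1 / (b * c * d * q ^+ (2 * n)) -> (n <= m)%N ->
  a != 0 -> b != 0 -> c != 0 -> d != 0 ->
  gen a -> gen c -> gen e -> gen (a / b) -> gen (a / c) -> gen (a / d) ->
  gen (a / (b * c * d)) -> gen (a / (b * c)) -> gen (c / b) -> gen (e / d) ->
  gen (a / (b * d)) -> gen (a / (c * d)) ->
  (forall i, (0 < i <= m)%N -> th (q ^+ i) != 0) ->
  multi_sum a b c d e n m = multi_closed a b c d e n m.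
Proof.
move=> q0 thP def_e le_nm a0 b0 c0 d0 ga gc ge gab gac gad gabcd gabc gcb ged gabd gacd gq.
have e0 : e != 0 by rewrite def_e; nonzero.
have gV x y : x != 0 -> y != 0 -> gen (x / y) -> gen (y / x).
  by move=> x0 y0 g; rewrite -invf_div; apply: genericV => //; nonzero.
rewrite /multi_sum /multi_closed (generic_sum q0 thP def_e) //.
- by rewrite (tri_monomial q0).
- by apply: gV => //; nonzero.
- by apply: gV => //; nonzero.
- exact: gV.
- exact: gV.
Qed.

(** The last factorial of the closed form is covered by the hypothesis because
    its arguments are inverses of arguments of [(a q / e; q, p)_m]. *)
Lemma closed_denom_neq0 a b c d e m n i : q != 0 -> theta_like th ->
  e = a ^+ 2 * q ^+ m.+1 / (b * c * d * q ^+ (2 * n)) ->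
  a != 0 -> b != 0 -> c != 0 -> d != 0 ->
  (forall k, (k <= m)%N -> pch q k * pch (a * q / b) k * pch (a * q / c) k *
     pch (a * q / d) k * pch (a * q / e) k * pch (a * q ^+ m.+1) k != 0) ->
  pch q (m - i) * pch (a * q / b) (m - i) * pch (a * q / c) (m - i) *
  pch (a * q / d) (m - i) *
  pch (a * q ^+ i.+1 / (b * c * d * q ^+ (2 * n))) (m - i) != 0.
Proof.
move=> q0 [_ thV _] def_e a0 b0 c0 d0 D.
have := D (m - i)%N (leq_subr _ _); rewrite !mulf_eq0 !negb_or.
case/andP => /andP[/andP[/andP[/andP[-> ->] ->] ->] _] _ /=.
apply/prodf_neq0 => l _; have lt_l := ltn_ord l.
have := D m (leqnn m); rewrite !mulf_eq0 !negb_or => /andP[/andP[_ h] _].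
have lt_l' : (m - i - l.+1 < m)%N by lia.
move/prodf_neq0: h => /(_ (Ordinal lt_l') isT) /=.
have -> : a * q / e * q ^+ (m - i - l.+1) =
   (a * q ^+ i.+1 / (b * c * d * q ^+ (2 * n)) * q ^+ l)^-1.
  have e1 : q ^+ m = q ^+ (m - i - l.+1) * q ^+ i * (q * q ^+ l).
    by rewrite -exprS -!exprD; congr (_ ^+ _); lia.
  by rewrite def_e !(exprS q m) e1 (exprS q i); fieldnz.
rewrite thV; last by nonzero.
by rewrite mulf_eq0 negb_or => /andP[].
Qed.

Lemma theta_qX_neq0 m i : (forall k, (k <= m)%N -> pch q k != 0) ->
  (0 < i <= m)%N -> th (q ^+ i) != 0.
Proof.
move=> D; case: i => // i /andP[_ lt_im].
by have := D _ lt_im; rewrite pochS mulf_eq0 negb_or -exprS => /andP[].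
Qed.

Lemma prod6_neq0l (x1 x2 x3 x4 x5 x6 : F) :
  x1 * x2 * x3 * x4 * x5 * x6 != 0 -> x1 != 0.
Proof. by rewrite !mulf_eq0 !negb_or -!andbA => /andP[]. Qed.

End MultipleSum.

(** * Convergent complex sequences *)

Section ComplexSequences.
Local Open Scope classical_set_scope.
Local Open Scope ring_scope.
Variable R : realType.
Implicit Types (u v : nat -> R[i]) (l x y : R[i]) (r : nat -> R).

(** The modulus with values in [R]; the norm of [R[i]] takes its values in
    [R[i]] itself, where the completeness of [R] cannot be used. *)
Definition nm x : R := Normc.normc x.

Lemma nmE x : `|x| = (nm x)%:C. Proof. by []. Qed.
Lemma nm_ge0 x : 0 <= nm x. Proof. by rewrite -lecR -nmE normr_ge0. Qed.
Lemma nm0 : nm 0 = 0. Proof. exact: Normc.normc0. Qed.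
Lemma nm1 : nm 1 = 1. Proof. exact: Normc.normc1. Qed.
Lemma nmM x y : nm (x * y) = nm x * nm y. Proof. exact: Normc.normcM. Qed.
Lemma nmV x : nm x^-1 = (nm x)^-1. Proof. exact: Normc.normcV. Qed.
Lemma nmN x : nm (- x) = nm x. Proof. exact: normcN. Qed.
Lemma nmD x y : nm (x + y) <= nm x + nm y. Proof. exact: le_normcD. Qed.
Lemma nmBC x y : nm (x - y) = nm (y - x). Proof. by rewrite -nmN opprB. Qed.
Lemma nmX x n : nm (x ^+ n) = nm x ^+ n.
Proof. by elim: n => [|n IHn]; rewrite ?expr0 ?nm1 // !exprS nmM IHn. Qed.
Lemma nm_eq0 x : (nm x == 0) = (x == 0).
Proof. by apply/eqP/eqP => [/Normc.eq0_normc|->] //; exact: nm0. Qed.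
Lemma nm_gt0 x : (0 < nm x) = (x != 0).
Proof. by rewrite lt0r nm_eq0 nm_ge0 andbT. Qed.
Lemma nm_sum (I : Type) (s : seq I) (P : pred I) (f : I -> R[i]) :
  nm (\sum_(i <- s | P i) f i) <= \sum_(i <- s | P i) nm (f i).
Proof.
elim/big_ind2: _ => [|x a y b hx hy|//]; first by rewrite nm0.
exact: le_trans (nmD _ _) (lerD hx hy).
Qed.
Lemma nm_real (t : R) : nm t%:C = `|t|.
Proof. by rewrite /nm /= expr0n /= addr0 sqrtr_sqr. Qed.

Lemma nm_i : nm ('i%C : R[i]) = 1.
Proof. by rewrite /nm /= expr0n expr1n add0r sqrtr1. Qed.

(** An inductive wrapper keeps unification from unfolding the filters. *)
Variant tendsto u l : Prop :=
  Tendsto of (u : nat -> R[i]^o) @ \oo --> (l : R[i]^o).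

Lemma tendstoP u l :
  tendsto u l <-> (fun n => nm (u n - l)) @ \oo --> (0 : R).
Proof.
split=> [[ul]|ul].
  apply/cvgrPdist_lt => e e0; have eC0 : 0 < e%:C :> R[i] by rewrite ltcR.
  apply: filterS (proj1 (cvgrPdist_lt _ _) ul _ eC0) => n h.
  rewrite sub0r normrN ger0_norm ?nm_ge0 //.
  by move: h; rewrite nmE ltcR nmBC.
split; apply/cvgrPdist_lt => e; rewrite ltcE /= => /andP[/eqP Ie e0].
apply: filterS (proj1 (cvgrPdist_lt _ _) ul _ e0) => n h.
rewrite nmE nmBC ltcE /= Ie eqxx; move: h.
by rewrite sub0r normrN ger0_norm ?nm_ge0.
Qed.

Lemma tendsto_squeeze u l r :
  (forall n, nm (u n - l) <= r n) -> r @ \oo --> (0 : R) -> tendsto u l.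
Proof.
move=> ur r0; apply/tendstoP; apply: (@squeeze_cvgr _ _ _ _ (cst 0) r) => //.
- by apply: nearW => n; rewrite nm_ge0 ur.
- exact: cvg_cst.
Qed.

Lemma tendsto_cst l : tendsto (fun=> l) l.
Proof. by split; exact: cvg_cst. Qed.

Lemma tendstoD u v l k :
  tendsto u l -> tendsto v k -> tendsto (fun n => u n + v n) (l + k).
Proof. by move=> [ul] [vk]; split; exact: (cvgD ul vk). Qed.

Lemma tendstoN u l : tendsto u l -> tendsto (fun n => - u n) (- l).
Proof. by move=> [ul]; split; exact: (cvgN ul). Qed.

Lemma tendstoM u v l k :
  tendsto u l -> tendsto v k -> tendsto (fun n => u n * v n) (l * k).
Proof. by move=> [ul] [vk]; split; exact: (cvgM ul vk). Qed.

Lemma tendstoV u l : l != 0 -> tendsto u l -> tendsto (fun n => (u n)^-1) l^-1.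
Proof. by move=> l0 [ul]; split; exact: (cvgV l0 ul). Qed.

Lemma tendstoX u l k : tendsto u l -> tendsto (fun n => u n ^+ k) (l ^+ k).
Proof.
move=> ul; elim: k => [|k IHk]; first exact: tendsto_cst.
under eq_fun do rewrite exprS; rewrite exprS; exact: tendstoM.
Qed.

Lemma tendsto_sum (I : Type) (s : seq I) (P : pred I) (f : I -> nat -> R[i])
    (g : I -> R[i]) :
  (forall i, P i -> tendsto (f i) (g i)) ->
  tendsto (fun n => \sum_(i <- s | P i) f i n) (\sum_(i <- s | P i) g i).
Proof.
move=> fg; elim: s => [|i s IHs].
  by under eq_fun do rewrite big_nil; rewrite big_nil; apply: tendsto_cst.
under eq_fun do rewrite big_cons; rewrite big_cons.
case Pi: (P i); [exact: (tendstoD (fg i Pi) IHs) | exact: IHs].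
Qed.

Lemma tendsto_prod (I : Type) (s : seq I) (P : pred I) (f : I -> nat -> R[i])
    (g : I -> R[i]) :
  (forall i, P i -> tendsto (f i) (g i)) ->
  tendsto (fun n => \prod_(i <- s | P i) f i n) (\prod_(i <- s | P i) g i).
Proof.
move=> fg; elim: s => [|i s IHs].
  by under eq_fun do rewrite big_nil; rewrite big_nil; apply: tendsto_cst.
under eq_fun do rewrite big_cons; rewrite big_cons.
case Pi: (P i); [exact: (tendstoM (fg i Pi) IHs) | exact: IHs].
Qed.

Lemma tendsto_unique u l k : tendsto u l -> tendsto u k -> l = k.
Proof. by move=> [ul] [uk]; apply: (cvg_unique _ ul uk); apply: norm_hausdorff. Qed.

Lemma tendsto_lim u l : tendsto u l -> limn (u : nat -> R[i]^o) = l.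
Proof. by move=> [ul]; apply/cvg_lim => //; apply: norm_hausdorff. Qed.

Lemma tendsto_S u l : tendsto u l -> tendsto (fun n => u n.+1) l.
Proof. by move=> [ul]; split; rewrite (cvg_shiftS (u : nat -> R[i]^o)). Qed.

Lemma tendsto_nm u l : tendsto u l -> (fun n => nm (u n)) @ \oo --> nm l.
Proof.
move=> /tendstoP ul; apply/cvgrPdist_lt => e e0.
apply: filterS (proj1 (cvgrPdist_lt _ _) ul _ e0) => n /=.
rewrite sub0r normrN ger0_norm ?nm_ge0 //; apply: le_lt_trans.
have h1 := nmD (u n - l) l; have h2 := nmD (l - u n) (u n).
rewrite subrK in h1; rewrite subrK nmBC in h2.
by rewrite ler_norml; apply/andP; split; lra.
Qed.

Lemma tendsto_nm_le u l (B : R) :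
  tendsto u l -> (forall n, nm (u n) <= B) -> nm l <= B.
Proof.
move=> /tendsto_nm ul uB; apply: (ler_cvg_to ul (cvg_cst B)); exact: nearW.
Qed.

Lemma cvg_geo (M rho : R) : 0 <= rho < 1 -> (fun n => M * rho ^+ n) @ \oo --> (0 : R).
Proof.
move=> /andP[rho0 rho1]; rewrite -[X in _ --> X](mulr0 M).
by apply: cvgM; [exact: cvg_cst | apply: cvg_expr; rewrite ger0_norm].
Qed.

Lemma real_cvg_of_geo (w : nat -> R) (M rho : R) : 0 <= rho < 1 -> 0 <= M ->
  (forall n, `|w n.+1 - w n| <= M * rho ^+ n) -> cvgn w.
Proof.
move=> /andP[rho0 rho1] M0 h.
have -> : w = fun n => w 0%N + series (telescope w) n.
  by apply/funext => n; rewrite -eq_sum_telescope.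
apply: is_cvgD; first exact: is_cvg_cst.
apply: normed_cvg; apply: (@series_le_cvg _ _ (geometric M rho)).
- by move=> n /=.
- by move=> n /=; rewrite mulr_ge0 // exprn_ge0.
- exact: h.
- by apply: is_cvg_geometric_series; rewrite ger0_norm.
Qed.

(** Completeness is inherited from [R] through real and imaginary parts. *)
Lemma tendsto_of_geo u (M rho : R) : 0 <= rho < 1 -> 0 <= M ->
  (forall n, nm (u n.+1 - u n) <= M * rho ^+ n) -> exists l, tendsto u l.
Proof.
move=> rho01 M0 h.
have hRe : cvgn (fun n => complex.Re (u n)).
  apply: (@real_cvg_of_geo (fun n => complex.Re (u n)) _ _ rho01 M0) => n.
  apply: le_trans (h n); rewrite -raddfB -lecR -nmE; exact: normc_ge_Re.
have hIm : cvgn (fun n => complex.Im (u n)).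
  apply: (@real_cvg_of_geo (fun n => complex.Im (u n)) _ _ rho01 M0) => n.
  apply: le_trans (h n); rewrite -raddfB -lecR -nmE.
  have := normc_ge_Re ((u n.+1 - u n) * 'i%C).
  by rewrite ReiNIm normrN normrM [`|'i%C|]nmE nm_i mulr1.
exists (limn (fun n => complex.Re (u n)) +i* limn (fun n => complex.Im (u n))).
have t0 : (fun n => `|complex.Re (u n) - limn (fun n => complex.Re (u n))| +
                    `|complex.Im (u n) - limn (fun n => complex.Im (u n))|) @ \oo --> (0 : R).
  rewrite -[X in _ --> X](addr0 0); apply: cvgD.
    by rewrite -(normr0 R) -[X in `|X|](subrr (limn (fun n => complex.Re (u n))));
       apply: cvg_norm; apply: cvgB => //; apply: cvg_cst.
  by rewrite -(normr0 R) -[X in `|X|](subrr (limn (fun n => complex.Im (u n))));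
     apply: cvg_norm; apply: cvgB => //; apply: cvg_cst.
apply: tendsto_squeeze t0 => n.
set a := limn _; set b := limn _.
have -> : u n - (a +i* b) = (complex.Re (u n) - a)%:C + 'i%C * (complex.Im (u n) - b)%:C.
  by case: (u n) => c d /=; simpc.
apply: le_trans (nmD _ _) _; rewrite nmM !nm_real.
by rewrite nm_i mul1r.
Qed.

End ComplexSequences.

(** * The infinite product and the theta function *)

Section QPoch.
Local Open Scope classical_set_scope.
Local Open Scope ring_scope.
Variables (R : realType) (p : R[i]).
Hypothesis p1 : nm p < 1.
Implicit Types (x y : R[i]).
Local Notation rho := (nm p).

Definition qpoch (x : R[i]) (n : nat) : R[i] := \prod_(0 <= k < n) (1 - x * p ^+ k).

Lemma rho01 : 0 <= rho < 1.
Proof. by rewrite nm_ge0. Qed.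

Lemma qpochS x n : qpoch x n.+1 = qpoch x n * (1 - x * p ^+ n).
Proof. by rewrite /qpoch big_nat_recr. Qed.

Lemma qpochSl x n : qpoch x n.+1 = (1 - x) * qpoch (x * p) n.
Proof.
rewrite /qpoch big_nat_recl // expr0 mulr1; congr (_ * _).
by apply: eq_bigr => k _; rewrite exprS mulrA.
Qed.

(** A Lipschitz estimate for products, uniform in the number of factors.  It
    serves for the continuity of the infinite product and for bounding it away
    from 0 near the origin. *)
Lemma prod_subr_nm_le (a b : nat -> R[i]) n :
  nm (\prod_(0 <= k < n) (1 - a k) - \prod_(0 <= k < n) (1 - b k)) <=
  \prod_(0 <= k < n) (1 + (nm (a k) + nm (b k))) *
  \sum_(0 <= k < n) nm (a k - b k).
Proof.
have prod_le (c : nat -> R[i]) (r : nat -> R) k : (forall j, nm (c j) <= r j) ->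
    nm (\prod_(0 <= j < k) c j) <= \prod_(0 <= j < k) r j.
  move=> cr; elim: k => [|k IHk]; first by rewrite !big_nil nm1.
  by rewrite !big_nat_recr //= nmM ler_pM // nm_ge0.
elim: n => [|n IHn]; first by rewrite !big_nil subrr nm0 mulr0.
rewrite !big_nat_recr //=.
set A := \prod_(0 <= i < n) (1 - a i) in IHn *.
set B := \prod_(0 <= i < n) (1 - b i) in IHn *.
set M := \prod_(0 <= i < n) _ in IHn *; set S := \sum_(0 <= i < n) _ in IHn *.
have -> : A * (1 - a n) - B * (1 - b n) = (A - B) * (1 - a n) - B * (a n - b n).
  by ring.
have hM : nm B <= M.
  apply: prod_le => j; have := nmD 1 (- b j); rewrite nm1 nmN => h.
  apply: le_trans h _; rewrite lerD2l lerDr; exact: nm_ge0.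
have M0 : 0 <= M := le_trans (nm_ge0 _) hM.
have h1 : nm (1 - a n) <= 1 + (nm (a n) + nm (b n)).
  have := nmD 1 (- a n); rewrite nm1 nmN => h.
  by apply: le_trans h _; rewrite lerD2l lerDl nm_ge0.
apply: le_trans (nmD _ _) _; rewrite nmN !nmM.
have e1 : nm (A - B) * nm (1 - a n) <= M * S * (1 + (nm (a n) + nm (b n))).
  by rewrite ler_pM // nm_ge0.
have e2 : nm B * nm (a n - b n) <= M * (1 + (nm (a n) + nm (b n))) * nm (a n - b n).
  rewrite ler_wpM2r ?nm_ge0 //; apply: le_trans hM _; rewrite ler_peMr //.
  by rewrite lerDl addr_ge0 ?nm_ge0.
apply: le_trans (lerD e1 e2) _; rewrite le_eqVlt; apply/orP; left; apply/eqP; ring.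
Qed.

Let one_sub_rho_gt0 : 0 < 1 - rho. Proof. by rewrite subr_gt0. Qed.

Lemma sum_geo_le n : \sum_(0 <= k < n) rho ^+ k <= (1 - rho)^-1.
Proof.
have -> : \sum_(0 <= k < n) rho ^+ k = (1 - rho ^+ n) / (1 - rho).
  apply: (canRL (mulfK (lt0r_neq0 one_sub_rho_gt0))).
  elim: n => [|n IHn]; first by rewrite big_nil expr0 mul0r subrr.
  by rewrite big_nat_recr //= mulrDl IHn exprS; ring.
rewrite ler_pdivrMr // mulVf ?lt0r_neq0 // gerBl exprn_ge0 //; exact: nm_ge0.
Qed.

Lemma prod_1Dgeo_le (t : R) n : 0 <= t ->
  \prod_(0 <= k < n) (1 + t * rho ^+ k) <= expR (t / (1 - rho)).
Proof.
move=> t0; apply: (@le_trans _ _ (expR (\sum_(0 <= k < n) t * rho ^+ k))).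
  elim: n => [|n IHn]; first by rewrite !big_nil expR0.
  rewrite !big_nat_recr //= expRD ler_pM ?expR_ge1Dx //.
    by apply: prodr_ge0 => k _; rewrite addr_ge0 // mulr_ge0 // exprn_ge0 ?nm_ge0.
  by rewrite addr_ge0 // mulr_ge0 // exprn_ge0 ?nm_ge0.
by rewrite ler_expR -mulr_sumr ler_wpM2l // sum_geo_le.
Qed.

Lemma qpoch_sub_le x y n : nm (qpoch x n - qpoch y n) <=
  expR ((nm x + nm y) / (1 - rho)) * (nm (x - y) / (1 - rho)).
Proof.
apply: le_trans (prod_subr_nm_le _ _ _) _.
have -> : \prod_(0 <= k < n) (1 + (nm (x * p ^+ k) + nm (y * p ^+ k))) =
    \prod_(0 <= k < n) (1 + (nm x + nm y) * rho ^+ k).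
  by apply: eq_bigr => k _; rewrite !nmM !nmX mulrDl.
have -> : \sum_(0 <= k < n) nm (x * p ^+ k - y * p ^+ k) =
    nm (x - y) * \sum_(0 <= k < n) rho ^+ k.
  by rewrite mulr_sumr; apply: eq_bigr => k _; rewrite -mulrBl nmM nmX.
apply: ler_pM.
- apply: prodr_ge0 => k _.
  by rewrite addr_ge0 // mulr_ge0 ?exprn_ge0 ?addr_ge0 ?nm_ge0.
- rewrite mulr_ge0 ?nm_ge0 // sumr_ge0 // => k _.
  by rewrite exprn_ge0 ?nm_ge0.
- by rewrite prod_1Dgeo_le // addr_ge0 ?nm_ge0.
by rewrite ler_wpM2l ?nm_ge0 // sum_geo_le.
Qed.

Lemma qpoch_nm_le x n : nm (qpoch x n) <= expR (nm x / (1 - rho)).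
Proof.
apply: le_trans (prod_1Dgeo_le n (nm_ge0 x)).
elim: n => [|n IHn]; first by rewrite /qpoch !big_nil nm1.
rewrite qpochS big_nat_recr //= nmM ler_pM ?nm_ge0 //.
by have := nmD 1 (- (x * p ^+ n)); rewrite nm1 nmN nmM nmX.
Qed.

Lemma qpoch_tendsto x : tendsto (qpoch x) (qpoch_inf p x).
Proof.
have [|n|l xl] := @tendsto_of_geo R (qpoch x) (expR (nm x / (1 - rho)) * nm x) rho rho01.
- by rewrite mulr_ge0 ?expR_ge0 ?nm_ge0.
- rewrite qpochS -[X in _ - X]mulr1 -mulrBr addrAC subrr sub0r nmM nmN nmM nmX mulrA.
  rewrite ler_wpM2r ?exprn_ge0 ?nm_ge0 // ler_wpM2r ?nm_ge0 //.
  exact: qpoch_nm_le.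
by rewrite /qpoch_inf [limn _](tendsto_lim xl).
Qed.

Lemma qpoch_inf_sub_le x y : nm (qpoch_inf p x - qpoch_inf p y) <=
  expR ((nm x + nm y) / (1 - rho)) * (nm (x - y) / (1 - rho)).
Proof.
have t := tendstoD (qpoch_tendsto x) (tendstoN (qpoch_tendsto y)).
exact: (tendsto_nm_le t (qpoch_sub_le x y)).
Qed.

Lemma qpoch_inf_continuous (u : nat -> R[i]) l :
  tendsto u l -> tendsto (fun n => qpoch_inf p (u n)) (qpoch_inf p l).
Proof.
move=> ul; apply: tendsto_squeeze (fun n => qpoch_inf_sub_le (u n) l) _.
rewrite -[X in _ --> X](mulr0 (expR ((nm l + nm l) / (1 - rho)))).
apply: cvgM.
  apply: (@cvg_comp _ _ _ _ expR); last exact: continuous_expR.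
  apply: cvgM; last exact: cvg_cst.
  by apply: cvgD; [exact: tendsto_nm | exact: cvg_cst].
rewrite -[X in _ --> X](mul0r (1 - rho)^-1).
by apply: cvgM; [exact/tendstoP | exact: cvg_cst].
Qed.

Lemma qpoch_inf_rec x : qpoch_inf p x = (1 - x) * qpoch_inf p (x * p).
Proof.
apply: tendsto_unique (tendsto_S (qpoch_tendsto x)) _.
under eq_fun do rewrite qpochSl.
exact: (tendstoM (tendsto_cst _) (qpoch_tendsto _)).
Qed.

Lemma qpoch_inf_split x n :
  qpoch_inf p x = qpoch x n * qpoch_inf p (x * p ^+ n).
Proof.
elim: n => [|n IHn]; first by rewrite /qpoch big_nil mul1r expr0 mulr1.
by rewrite IHn qpochS qpoch_inf_rec -!mulrA exprSr mulrA.
Qed.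

Lemma qpoch_inf0 : qpoch_inf p 0 = 1.
Proof.
apply: tendsto_unique (qpoch_tendsto 0) _.
rewrite (_ : qpoch 0 = fun=> 1); first exact: tendsto_cst.
by apply/funext => n; rewrite /qpoch big1 // => k _; rewrite mul0r subr0.
Qed.

Lemma qpoch_inf_nm_ge x : 1 - expR (nm x / (1 - rho)) * (nm x / (1 - rho)) <=
  nm (qpoch_inf p x).
Proof.
have := qpoch_inf_sub_le 0 x; rewrite nm0 add0r sub0r nmN.
rewrite qpoch_inf0.
have := nmD (1 - qpoch_inf p x) (qpoch_inf p x); rewrite subrK nm1.
lra.
Qed.

(** The tails of the product tend to 1, so one of the factors must vanish. *)
Lemma qpoch_inf_eq0 x : qpoch_inf p x = 0 -> exists k, x * p ^+ k = 1.
Proof.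
move=> x0; apply: contrapT => /forallNP h.
have qn n : qpoch_inf p (x * p ^+ n) = 0.
  move: x0; rewrite (qpoch_inf_split x n) => /eqP; rewrite mulf_eq0.
  case/orP => [|/eqP //]; rewrite prodf_seq_eq0 => /hasP[k _ /=].
  by rewrite subr_eq0 => /eqP e; case: (h k).
have lim1 : tendsto (fun n => x * p ^+ n) 0.
  apply: (@tendsto_squeeze _ _ _ (fun n => nm x * rho ^+ n)) => [n|].
    by rewrite subr0 nmM nmX.
  exact: cvg_geo rho01.
have := tendsto_unique (qpoch_inf_continuous lim1).
move=> /(_ 0); have -> : (fun n => qpoch_inf p (x * p ^+ n)) = fun=> 0.
  by apply/funext.
move=> /(_ (tendsto_cst _)) q00.
by have := qpoch_inf_nm_ge 0; rewrite nm0 mul0r mulr0 subr0 q00 nm0 ler10.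
Qed.

Lemma thetaV x : x != 0 -> theta p x^-1 = - x^-1 * theta p x.
Proof.
move=> x0; rewrite /theta invrK (qpoch_inf_rec x^-1) (qpoch_inf_rec x).
by rewrite ![p * _]mulrC; field.
Qed.

Lemma theta1 : theta p 1 = 0.
Proof. by rewrite /theta qpoch_inf_rec subrr !mul0r. Qed.

Lemma theta_eq0 x : x != 0 -> theta p x = 0 -> exists j : int, x = p ^ j.
Proof.
move=> x0 /eqP; rewrite mulf_eq0 => /orP[] /eqP /qpoch_inf_eq0[k].
  move=> e; exists (- k%:Z); rewrite -[x]mulr1 -exprnN.
  have pk : p ^+ k != 0 by apply: contraPneq e => ->; rewrite mulr0 => /esym/eqP; rewrite oner_eq0.
  by apply: (mulIf pk); rewrite mulr1 mulVf.
by move=> e; exists k.+1%:Z; rewrite -exprnP exprS -[LHS]mulr1 -e; field.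
Qed.

Lemma theta_continuous (u : nat -> R[i]) l : l != 0 ->
  tendsto u l -> tendsto (fun n => theta p (u n)) (theta p l).
Proof.
move=> l0 ul; apply: tendstoM; first exact: qpoch_inf_continuous.
apply: qpoch_inf_continuous; apply: (tendstoM (tendsto_cst _)).
exact: tendstoV.
Qed.

End QPoch.

(** * Jacobi's triple product *)

Section GaussianBinomial.
Variables (F : fieldType) (p : F).

(** The Gaussian binomial, by Pascal's rule, which avoids quotients. *)
Fixpoint gbin (n j : nat) : F :=
  match n, j with
  | _, 0 => 1
  | 0, _.+1 => 0
  | n'.+1, j'.+1 => gbin n' j'.+1 + p ^+ (n' - j') * gbin n' j'
  end.

Lemma gbin_small n j : (n < j)%N -> gbin n j = 0.
Proof.
elim: n j => [|n IHn] [|j] //= lt_nj; rewrite !IHn ?mulr0 ?addr0 //.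
exact: leqW.
Qed.

Lemma gbin0 n : gbin n 0 = 1. Proof. by case: n. Qed.

Lemma prod_gbin (z : F) n : \prod_(0 <= k < n) (1 + z * p ^+ k) =
  \sum_(0 <= j < n.+1) p ^+ 'C(j, 2) * gbin n j * z ^+ j.
Proof.
elim: n => [|n IHn]; first by rewrite big_nil big_nat1 !expr0 !mulr1.
rewrite big_nat_recr //= IHn [RHS]big_nat_recl //= expr0 !mulr1.
under [X in _ = _ + X]eq_bigr => j _ do rewrite mulrDr mulrDl.
rewrite big_split /= addrA.
have -> : 1 + \sum_(0 <= j < n.+1) p ^+ 'C(j.+1, 2) * gbin n j.+1 * z ^+ j.+1 =
   \sum_(0 <= j < n.+1) p ^+ 'C(j, 2) * gbin n j * z ^+ j.
  rewrite [RHS]big_nat_recl //= gbin0 expr0 !mulr1 big_nat_recr //=.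
  by rewrite gbin_small // mulr0 mul0r addr0.
rewrite mulrDr mulr1 mulr_suml; congr (_ + _).
apply: eq_big_nat => j /andP[_]; rewrite ltnS => le_jn.
have -> : p ^+ n = p ^+ (n - j) * p ^+ j by rewrite -exprD subnK.
by rewrite binS bin1 exprD exprS; ring.
Qed.

Lemma gbin_fact n j (f := fun n => \prod_(0 <= k < n) (1 - p * p ^+ k)) :
  (j <= n)%N -> f j * f (n - j)%N * gbin n j = f n.
Proof.
have fS k : f k.+1 = f k * (1 - p ^+ k.+1) by rewrite /f big_nat_recr //= -exprS.
have f0 : f 0%N = 1 by rewrite /f big_nil.
elim: n j => [|n IHn] [|j] //= le_jn.
- by rewrite f0 !mul1r.
- by rewrite f0 mul1r mulr1.
rewrite subSS mulrDr; rewrite ltnS in le_jn.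
have -> : f j.+1 * f (n - j)%N * (p ^+ (n - j) * gbin n j) =
   f n * (1 - p ^+ j.+1) * p ^+ (n - j) by rewrite fS -(IHn j) //; ring.
have -> : f j.+1 * f (n - j)%N * gbin n j.+1 = f n * (1 - p ^+ (n - j)).
  case: (ltngtP j n) le_jn => // [lt_jn _|-> _].
    have -> : f (n - j)%N = f (n - j.+1)%N * (1 - p ^+ (n - j)).
      by rewrite -(subnSK lt_jn) fS.
    by rewrite -(IHn j.+1) //; ring.
  by rewrite gbin_small // subnn expr0 subrr !mulr0.
have -> : f n.+1 = f n * (1 - p ^+ j.+1 * p ^+ (n - j)).
  by rewrite fS -exprD addSn subnKC.
ring.
Qed.

End GaussianBinomial.

(** [j (j - 1) / 2] for any integer [j], kept in [nat] because it is the
    exponent of a small quantity. *)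
Definition trin (j : int) : nat :=
  match j with Posz k => 'C(k, 2) | Negz k => 'C(k.+2, 2) end.

Lemma trinE j : (trin j)%:Z * 2 = j * (j - 1).
Proof.
have h n : ('C(n, 2) * 2 = n * n.-1)%N.
    rewrite bin2 muln2 halfK; have := odd_double_half (n * n.-1).
    by case: n => // n; rewrite oddM /= andNb subn0.
case: j => n /=.
  have := h n; case: n => [|n] //= e; have := congr1 Posz e; rewrite !PoszM; lia.
have := h n.+2; rewrite NegzE /= => e; have := congr1 Posz e; rewrite !PoszM; lia.
Qed.

Lemma bin2Z n : 'C(n, 2)%:Z * 2 = n%:Z * (n%:Z - 1).
Proof. exact: (trinE n%:Z). Qed.

Lemma trin_shift (n i : nat) :
  (trin (i%:Z - n%:Z) + n * i = 'C(n.+1, 2) + 'C(i, 2))%N.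
Proof.
have e1 := trinE (i%:Z - n%:Z); have e2 := bin2Z n.+1; have e3 := bin2Z i.
move: (trin _) ('C(n.+1, 2)) ('C(i, 2)) e1 e2 e3 => u v w; nia.
Qed.

Definition sym_range (n : nat) : seq int := [seq i%:Z - n%:Z | i <- index_iota 0 (2 * n).+1].

Lemma mem_sym_range n (j : int) : (j \in sym_range n) = (- n%:Z <= j <= n%:Z).
Proof.
apply/mapP/idP => [h|/andP[h1 h2]].
  by case: h => i; rewrite mem_index_iota => ? ->; lia.
exists (absz (j + n%:Z)); first by rewrite mem_index_iota; lia.
lia.
Qed.

Lemma sym_range_uniq n : uniq (sym_range n).
Proof. by rewrite map_inj_uniq ?iota_uniq // => i j /addIr; case. Qed.

Section TripleProduct.
Local Open Scope classical_set_scope.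
Local Open Scope ring_scope.
Variables (R : realType) (p : R[i]).
Hypotheses (p1 : nm p < 1) (p0 : p != 0).
Implicit Types (x y : R[i]).
Local Notation rho := (nm p).

(** The term of index [j] of the bilateral series in Jacobi's identity. *)
Definition lterm x (j : int) : R[i] := (- x) ^ j * p ^+ trin j.
Definition lsum x (n : nat) : R[i] := \sum_(j <- sym_range n) lterm x j.

(** The finite form of the triple product identity: the q-binomial theorem
    with [2 n] factors, recentred at the middle factor. *)
Lemma qpoch_mul_gbin x n : x != 0 ->
  qpoch p x n * qpoch p (p / x) n =
  \sum_(0 <= i < (2 * n).+1) gbin p (2 * n) i * lterm x (i%:Z - n%:Z).
Proof.
move=> x0; have pX k : p ^+ k != 0 by rewrite expf_neq0.
have Nx0 : - x != 0 by rewrite oppr_eq0.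
(* The factors below the middle one are turned over, 1 - y = - y (1 - 1 / y);
   W collects the monomials. *)
pose W := \prod_(0 <= k < n) (- x / p ^+ k.+1).
have WE : W = (- x) ^+ n / p ^+ 'C(n.+1, 2).
  rewrite {}/W; elim: n => [|k IHk].
    by rewrite big_nil expr0 bin_small // expr0 divr1.
  rewrite big_nat_recr //= IHk [in RHS]binS bin1 exprD [in RHS]exprSr; field.
  by rewrite !pX.
have W0 : W != 0 by rewrite WE mulf_neq0 ?invr_neq0 ?expf_neq0.
have := prod_gbin p (- x / p ^+ n) (2 * n).
rewrite (@big_cat_nat _ _ _ n) //=; last by rewrite mul2n -addnn leq_addr.
have -> : \prod_(0 <= k < n) (1 + - x / p ^+ n * p ^+ k) = W * qpoch p (p / x) n.
  rewrite big_nat_rev /W /qpoch -big_split /=; apply: eq_big_nat => k /andP[_ lt_kn].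
  rewrite add0n.
  have -> : p ^+ n = p ^+ (n - k.+1) * (p * p ^+ k) by rewrite -exprS -exprD subnK.
  by rewrite exprS; field; rewrite pX p0 x0 pX.
have -> : \prod_(n <= k < 2 * n) (1 + - x / p ^+ n * p ^+ k) = qpoch p x n.
  rewrite mul2n -addnn -{1}[n]add0n big_addn addnK; apply: eq_big_nat => k _.
  by rewrite exprD; field; rewrite pX.
move=> E; apply: (mulfI W0).
have -> : W * (qpoch p x n * qpoch p (p / x) n) =
   W * qpoch p (p / x) n * qpoch p x n by ring.
rewrite E mulr_sumr; apply: eq_bigr => i _; rewrite WE /lterm.
rewrite expfzDr // -exprnN -exprnP expr_div_n -exprM.
have e : p ^+ trin (i%:Z - n%:Z) * p ^+ (n * i) =
    p ^+ 'C(n.+1, 2) * p ^+ 'C(i, 2) by rewrite -!exprD trin_shift.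
have Xn0 : (- x) ^+ n != 0 by rewrite expf_neq0.
apply: (mulIf (mulf_neq0 (pX (n * i)%N) (pX 'C(n.+1, 2)))).
transitivity (p ^+ 'C(n.+1, 2) * p ^+ 'C(i, 2) * gbin p (2 * n) i * (- x) ^+ i).
  by field; rewrite pX.
by rewrite -e; field; rewrite Xn0 pX.
Qed.

(** The q-binomial theorem without its binomials, which are at least 1 since
    [rho] is nonnegative. *)
Lemma sum_bin2_le (t : R) n : 0 <= t ->
  \sum_(0 <= k < n.+1) rho ^+ 'C(k, 2) * t ^+ k <= expR (t / (1 - rho)).
Proof.
move=> t0; apply: le_trans (prod_1Dgeo_le p1 n t0).
elim: n t t0 => [|n IHn] t t0; first by rewrite big_nil big_nat1 !expr0 mulr1.
rewrite [leLHS]big_nat_recl // [leRHS]big_nat_recl //= !expr0 !mulr1.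
have := IHn (t * rho) (mulr_ge0 t0 (nm_ge0 _)).
have -> : \prod_(0 <= k < n) (1 + t * rho * rho ^+ k) =
    \prod_(0 <= k < n) (1 + t * rho ^+ k.+1).
  by apply: eq_bigr => k _; rewrite exprS mulrA.
set P := \prod_(0 <= k < n) _; move=> h.
have -> : \sum_(0 <= k < n.+1) rho ^+ 'C(k.+1, 2) * t ^+ k.+1 =
    t * \sum_(0 <= k < n.+1) rho ^+ 'C(k, 2) * (t * rho) ^+ k.
  rewrite mulr_sumr; apply: eq_bigr => k _.
  by rewrite binS bin1 exprD exprMn exprS; ring.
have P1 : 1 <= P.
  apply: le_trans h; rewrite big_nat_recl // !expr0 mulr1 lerDl sumr_ge0 // => k _.
  by rewrite !mulr_ge0 ?exprn_ge0 ?mulr_ge0 ?nm_ge0.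
rewrite mulrDl mul1r lerD // ler_wpM2l //.
Qed.

Lemma nm_lterm x j : x != 0 -> nm (lterm x j) = (nm x) ^ j * rho ^+ trin j.
Proof.
move=> x0; rewrite /lterm nmM nmX; congr (_ * _).
case: j => n; first by rewrite -!exprnP nmX nmN.
by rewrite NegzE -!exprnN nmV nmX nmN.
Qed.

Lemma labs_bounded x : x != 0 -> exists2 B : R, 0 <= B &
  forall n, \sum_(j <- sym_range n) nm (lterm x j) <= B.
Proof.
move=> x0; have nx0 : 0 < nm x by rewrite nm_gt0.
exists (expR (rho / nm x / (1 - rho)) + expR (nm x / (1 - rho))).
  by rewrite addr_ge0 ?expR_ge0.
move=> n; rewrite big_map (@big_cat_nat _ _ _ n) //=; last by lia.
rewrite lerD //.
  have h := sum_bin2_le n (divr_ge0 (nm_ge0 p) (nm_ge0 x)).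
  apply: le_trans h; rewrite [leRHS]big_nat_recl // !expr0 mulr1 ler_wpDl //.
  rewrite big_nat_rev /= le_eqVlt; apply/orP; left; apply/eqP.
  apply: eq_big_nat => k /andP[_ lt_kn]; rewrite nm_lterm // add0n.
  have -> : (n - k.+1)%N%:Z - n%:Z = - k.+1%:Z by lia.
  rewrite -exprnN -NegzE /= expr_div_n.
  by rewrite binS bin1 exprD; field; rewrite gt_eqF ?exprn_gt0.
have h := sum_bin2_le n (nm_ge0 x).
apply: le_trans h; rewrite -{1}[n]add0n big_addn.
have -> : ((2 * n).+1 - n = n.+1)%N by lia.
rewrite le_eqVlt; apply/orP; left; apply/eqP.
apply: eq_big_nat => k _; rewrite nm_lterm //.
have -> : (k + n)%N%:Z - n%:Z = k%:Z by lia.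
by rewrite -exprnP mulrC.
Qed.

Let one_sub_rho_gt0 : 0 < 1 - rho. Proof. by rewrite subr_gt0. Qed.

Lemma euler_neq0 : qpoch_inf p p != 0.
Proof.
apply/eqP => /(qpoch_inf_eq0 p1)[k]; rewrite -exprS => e.
have := congr1 (@nm R) e; rewrite nmX nm1 => e1.
by have := exprn_ilt1 k.+1 (nm_ge0 p) p1; rewrite e1 ltxx.
Qed.

Lemma euler_nm_le n : nm (qpoch p p n) <= expR (rho / (1 - rho)).
Proof. exact: qpoch_nm_le. Qed.

Lemma euler_nm_ge n :
  nm (qpoch_inf p p) / expR (1 / (1 - rho)) <= nm (qpoch p p n).
Proof.
rewrite ler_pdivrMr ?expR_gt0 // (qpoch_inf_split p1 _ n) nmM.
rewrite ler_wpM2l ?nm_ge0 //.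
apply: (tendsto_nm_le (qpoch_tendsto p1 _)) => k.
apply: le_trans (qpoch_nm_le p1 _ _) _; rewrite ler_expR ler_pM2r ?invr_gt0 //.
by rewrite -exprS nmX exprn_ile1 ?nm_ge0 // ltW.
Qed.

Lemma euler_sub_le n : nm (qpoch_inf p p - qpoch p p n) <=
  expR (rho / (1 - rho)) * (expR (1 / (1 - rho)) / (1 - rho)) * rho ^+ n.
Proof.
rewrite (qpoch_inf_split p1 _ n) -[X in _ - X]mulr1 -mulrBr nmM -mulrA.
apply: ler_pM; rewrite ?nm_ge0 ?euler_nm_le // nmBC.
have := qpoch_inf_sub_le p1 0 (p * p ^+ n).
rewrite (qpoch_inf0 p1).
move=> h; apply: le_trans h _; rewrite nm0 add0r sub0r nmN nmM nmX.
have le1 : rho * rho ^+ n <= rho ^+ n by rewrite ler_piMl ?exprn_ge0 ?nm_ge0 // ltW.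
have le2 : rho * rho ^+ n <= 1 by rewrite -exprS exprn_ile1 ?nm_ge0 // ltW.
rewrite -[leRHS]mulrA; apply: ler_pM.
- exact: expR_ge0.
- by rewrite divr_ge0 ?(ltW one_sub_rho_gt0) // -exprS exprn_ge0 // nm_ge0.
- by rewrite ler_expR ler_pM2r ?invr_gt0.
by rewrite mulrC ler_wpM2l // invr_ge0 ltW.
Qed.

(** Two rates, one for each end, because the binomial is far from its limit
    when [i] is close to 0 or to [n]. *)
Lemma gbin_limit_le : exists2 C : R, 0 <= C & forall n i, (i <= n)%N ->
  nm (qpoch_inf p p * gbin p n i - 1) <= C * (rho ^+ i + rho ^+ (n - i)).
Proof.
set phi := qpoch_inf p p; pose f := qpoch p p.
set E := expR (rho / (1 - rho)); set c := nm phi / expR (1 / (1 - rho)).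
set K := expR (rho / (1 - rho)) * (expR (1 / (1 - rho)) / (1 - rho)).
have E0 : 0 <= E by apply: expR_ge0.
have K0 : 0 <= K by rewrite mulr_ge0 ?divr_ge0 ?expR_ge0 // ltW.
have c0 : 0 < c by rewrite divr_gt0 ?expR_gt0 // nm_gt0 euler_neq0.
exists (2 * (E * K) / (c * c)) => [|n i le_in].
  have c0' := ltW c0.
  by apply: divr_ge0; [rewrite mulr_ge0 ?ler0n // mulr_ge0 | rewrite mulr_ge0].
have fc k : c <= nm (f k) by apply: euler_nm_ge.
have fE k : nm (f k) <= E by apply: euler_nm_le.
have fK k : nm (phi - f k) <= K * rho ^+ k by apply: euler_sub_le.
have f0 k : f k != 0 by rewrite -nm_gt0 (lt_le_trans c0).
have -> : phi * gbin p n i - 1 =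
    (phi * f n - f i * f (n - i)%N) / (f i * f (n - i)%N).
  have e : f i * f (n - i)%N * gbin p n i = f n := gbin_fact p le_in.
  by rewrite -e; field; rewrite !f0.
have -> : phi * f n - f i * f (n - i)%N =
  f n * (phi - f i) - f i * (phi - f n) + f i * (phi - f (n - i)%N) by ring.
set N := _ + _; rewrite nmM nmV [in X in _ <= X]mulrAC.
apply: ler_pM; rewrite ?nm_ge0 ?invr_ge0 ?nm_ge0 //; last first.
  have c0' := ltW c0; have cc : 0 < c * c by apply: mulr_gt0.
  have ff : 0 < nm (f i) * nm (f (n - i)%N) by rewrite mulr_gt0 ?nm_gt0 ?f0.
  by rewrite nmM lef_pV2 ?posrE // ler_pM.
have hN : nm N <= E * (K * rho ^+ i) + E * (K * rho ^+ n) + E * (K * rho ^+ (n - i)).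
  apply: le_trans (nmD _ _) _; apply: lerD; last first.
    by rewrite nmM ler_pM ?nm_ge0.
  apply: le_trans (nmD _ _) _; rewrite nmN.
  by apply: lerD; rewrite nmM ler_pM ?nm_ge0.
apply: le_trans hN _.
have le_n : rho ^+ n <= rho ^+ (n - i).
  by rewrite ler_wiXn2l ?nm_ge0 ?leq_subr // ltW.
have hi : 0 <= rho ^+ i by rewrite exprn_ge0 ?nm_ge0.
have EK : 0 <= E * K by rewrite mulr_ge0.
have h1 := ler_wpM2l EK le_n; have h2 := mulr_ge0 EK hi.
rewrite -!mulrA !mulrDr in h1 h2 *; lra.
Qed.

(** Dominated convergence in the finite form.  The errors [rho ^ i] and
    [rho ^ (2 n - i)] of the binomials amount to [rho ^ n] times the terms of
    the series at [x p] and at [x / p], whose sums are bounded. *)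
Theorem jacobi_triple_product x : x != 0 ->
  tendsto (lsum x) (qpoch_inf p p * theta p x).
Proof.
move=> x0; set phi := qpoch_inf p p; have [C C0 hC] := gbin_limit_le.
have xp0 : x * p != 0 by rewrite mulf_neq0.
have xpV0 : x / p != 0 by rewrite mulf_neq0 ?invr_eq0.
have [B1 B10 hB1] := labs_bounded xp0; have [B2 B20 hB2] := labs_bounded xpV0.
pose A n := phi * (qpoch p x n * qpoch p (p / x) n).
have At : tendsto A (phi * theta p x).
  apply: (tendstoM (tendsto_cst _)).
  exact: (tendstoM (qpoch_tendsto p1 _) (qpoch_tendsto p1 _)).
have D0 : tendsto (fun n => A n - lsum x n) 0.
  apply: (@tendsto_squeeze _ _ _ (fun n => C * (B1 + B2) * rho ^+ n)) => [n|]; last first.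
    by apply: cvg_geo; rewrite nm_ge0.
  rewrite subr0 /A qpoch_mul_gbin // /lsum big_map mulr_sumr -sumrB.
  apply: le_trans (nm_sum _ _ _) _.
  apply: (@le_trans _ _ (\sum_(0 <= i < (2 * n).+1)
    C * rho ^+ n * (nm (lterm (x * p) (i%:Z - n%:Z)) + nm (lterm (x / p) (i%:Z - n%:Z))))).
    rewrite big_nat_cond [leRHS]big_nat_cond; apply: ler_sum => i /andP[/andP[_ lt_i] _].
    rewrite -[X in _ - X]mul1r mulrA -mulrBl nmM.
    have np0 : rho != 0 by rewrite gt_eqF // nm_gt0.
    have nx0 : nm x != 0 by rewrite gt_eqF // nm_gt0.
    rewrite !nm_lterm // !nmM nmV !expfzMl exprz_inv.
    have e1 : rho ^ (i%:Z - n%:Z) = rho ^+ i / rho ^+ n.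
      by rewrite expfzDr // -exprnN -exprnP.
    have e2 : rho ^ (- (i%:Z - n%:Z)) = rho ^+ (2 * n - i) / rho ^+ n.
      rewrite opprB expfzDr // -exprnN -exprnP.
      apply: (mulIf (expf_neq0 i np0)); rewrite mulfVK ?expf_neq0 //.
      rewrite mulrAC -exprD subnK // mul2n -addnn exprD mulfK ?expf_neq0 //.
    rewrite e1 e2; set t := nm x ^ _; set w := rho ^+ trin _.
    have -> : C * rho ^+ n * (t * (rho ^+ i / rho ^+ n) * w +
         t * (rho ^+ (2 * n - i) / rho ^+ n) * w) =
        C * (rho ^+ i + rho ^+ (2 * n - i)) * (t * w).
      by field; rewrite expf_neq0.
    apply: ler_wpM2r; last exact: hC.
    by rewrite mulr_ge0 ?exprn_ge0 ?exprz_ge0 ?nm_ge0.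
  rewrite -mulr_sumr big_split /= mulrDr [C * (B1 + B2)]mulrDr mulrDl.
  have hs1 := hB1 n; have hs2 := hB2 n; rewrite !big_map in hs1 hs2.
  rewrite lerD //.
    by rewrite mulrAC ler_wpM2r ?exprn_ge0 ?nm_ge0 // ler_wpM2l.
  by rewrite mulrAC ler_wpM2r ?exprn_ge0 ?nm_ge0 // ler_wpM2l.
have := tendstoD At (tendstoN D0); rewrite oppr0 addr0.
by congr tendsto; apply/funext => n; ring.
Qed.

End TripleProduct.

(** * Weierstrass' three-term relation *)

Section FiniteRearrangement.
Variables (T : eqType).

Lemma big_uniq_sub (V : zmodType) (s s' : seq T) (f : T -> V) :
  uniq s -> uniq s' -> {subset s <= s'} ->
  \sum_(i <- s') f i = \sum_(i <- s) f i + \sum_(i <- s' | i \notin s) f i.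
Proof.
move=> us us' ss'; rewrite (bigID (mem s)) /=; congr (_ + _).
rewrite -big_filter; apply: perm_big; apply: uniq_perm; rewrite ?filter_uniq //.
move=> x; rewrite mem_filter; apply/andP/idP => [h|xs]; first by case: h.
by split=> //; apply: ss'.
Qed.

Lemma nm_sum_sub_le (R : realType) (s s1 s2 : seq T) (f : T -> R[i]) :
  uniq s -> uniq s1 -> uniq s2 -> {subset s <= s1} -> {subset s1 <= s2} ->
  nm (\sum_(i <- s1) f i - \sum_(i <- s) f i) <=
  \sum_(i <- s2) nm (f i) - \sum_(i <- s) nm (f i).
Proof.
move=> us us1 us2 ss1 ss2; rewrite (big_uniq_sub f us us1 ss1) addrAC subrr add0r.
apply: le_trans (nm_sum _ _ _) _.
rewrite (big_uniq_sub _ us1 us2 ss2) (big_uniq_sub _ us us1 ss1).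
have : 0 <= \sum_(i <- s2 | i \notin s1) nm (f i).
  by apply: sumr_ge0 => i _; apply: nm_ge0.
move: (\sum_(i <- s) _) (\sum_(i <- s1 | _) _) (\sum_(i <- s2 | _) _) => A B C; lra.
Qed.

End FiniteRearrangement.

Definition box (n : nat) : seq (int * int) := [seq (i, j) | i <- sym_range n, j <- sym_range n].
Definition even_pair (z : int * int) : int * int := (z.1 + z.2, z.1 - z.2).
Definition odd_pair (z : int * int) : int * int := (z.1 + z.2 + 1, z.1 - z.2).
(** The lattice is the disjoint union of its points with even and with odd
    coordinate sum; in the coordinates [s], [t] the double series separates on
    each of the two parts. *)
Definition rotated_box (n : nat) : seq (int * int) :=
  map even_pair (box n) ++ map odd_pair (box n).

Lemma mem_box n z :
  (z \in box n) = (- n%:Z <= z.1 <= n%:Z) && (- n%:Z <= z.2 <= n%:Z).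
Proof.
case: z => i j /=; rewrite -!mem_sym_range; apply/allpairsP/andP => [h|h].
  by case: h => -[a b] /= [ha hb [-> ->]].
by exists (i, j); case: h.
Qed.

Lemma box_uniq n : uniq (box n).
Proof. by apply: allpairs_uniq; rewrite ?sym_range_uniq // => -[a b] [c d]. Qed.

Lemma even_pair_inj : injective even_pair.
Proof.
move=> [a b] [c d] [] h1 h2; have -> : a = c by lia.
by have -> : b = d by lia.
Qed.

Lemma odd_pair_inj : injective odd_pair.
Proof.
move=> [a b] [c d] [] h1 h2; have -> : a = c by lia.
by have -> : b = d by lia.
Qed.

Lemma rotated_box_uniq n : uniq (rotated_box n).
Proof.
rewrite /rotated_box cat_uniq (map_inj_uniq even_pair_inj).
rewrite (map_inj_uniq odd_pair_inj) box_uniq andbT; apply/hasPn => z /mapP h.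
case: h => -[a b] _ -> {z}; apply/negP => /mapP h.
case: h => -[c d] _ [] h1 h2; lia.
Qed.

Lemma box_sub_rotated n : {subset box n <= rotated_box n}.
Proof.
move=> [i j]; rewrite mem_box /= mem_cat => h; apply/orP.
(* Adding 2 n makes the difference a natural number of the same parity. *)
pose k := absz (i - j + 2 * n%:Z); have kE : k%:Z = i - j + 2 * n%:Z by lia.
have [e|o] := boolP (odd k).
  right; apply/mapP; exists ((i + j - 1) %/ 2, (i - j - 1) %/ 2)%Z.
    rewrite mem_box /=; lia.
  rewrite /odd_pair /=; congr pair; lia.
left; apply/mapP; exists ((i + j) %/ 2, (i - j) %/ 2)%Z.
  rewrite mem_box /=; lia.
rewrite /even_pair /=; congr pair; lia.
Qed.

Lemma rotated_box_sub n : {subset rotated_box n <= box (2 * n).+1}.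
Proof.
move=> z; rewrite mem_cat => /orP[] /mapP h; case: h => -[a b];
  rewrite !mem_box /= => h ->; rewrite /even_pair /odd_pair /=; lia.
Qed.

Section ThetaProduct.
Local Open Scope classical_set_scope.
Local Open Scope ring_scope.
Variables (R : realType) (p : R[i]).
Hypotheses (p1 : nm p < 1) (p0 : p != 0).
Implicit Types (x y : R[i]).
Local Notation rho := (nm p).

Lemma sum_box (V : comPzSemiRingType) n (f g : int -> V) :
  \sum_(z <- box n) f z.1 * g z.2 =
  (\sum_(i <- sym_range n) f i) * (\sum_(j <- sym_range n) g j).
Proof.
rewrite big_allpairs_dep /= mulr_suml; apply: eq_bigr => i _.
by rewrite mulr_sumr.
Qed.

Let labs x (n : nat) : R := \sum_(j <- sym_range n) nm (lterm p x j).

Lemma labs_cvg x : x != 0 -> cvgn (labs x).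
Proof.
move=> x0; have [B _ hB] := labs_bounded p1 p0 x0.
apply: nondecreasing_is_cvgn.
  move=> n m le_nm; rewrite /labs (big_uniq_sub _ (sym_range_uniq n) (sym_range_uniq m)).
    by rewrite lerDl sumr_ge0 // => i _; apply: nm_ge0.
  by move=> j; rewrite !mem_sym_range; lia.
by exists B => _ [n _ <-]; exact: hB.
Qed.

Lemma cvg_sub_double (u : nat -> R) : cvgn u ->
  (fun n => u (2 * n).+1 - u n) @ \oo --> (0 : R).
Proof.
move=> uc; rewrite -(subrr (limn u)); apply: cvgB => //.
apply: (@cvg_comp _ _ _ (fun n => (2 * n).+1) u \oo \oo) => //.
move=> A [N _ hA]; exists N => // n /= le_Nn; apply: hA => /=; lia.
Qed.

(** The rotated square lies between two squares, so by absolute convergence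
    summation over it gives the product of the two series. *)
Lemma rotated_box_tendsto x y : x != 0 -> y != 0 ->
  tendsto (fun n => \sum_(z <- rotated_box n) lterm p x z.1 * lterm p y z.2)
    (qpoch_inf p p * theta p x * (qpoch_inf p p * theta p y)).
Proof.
move=> x0 y0; pose f (z : int * int) := lterm p x z.1 * lterm p y z.2.
have t1 := tendstoM (jacobi_triple_product p1 p0 x0)
                    (jacobi_triple_product p1 p0 y0).
have t2 : tendsto (fun n => \sum_(z <- rotated_box n) f z - \sum_(z <- box n) f z) 0.
  pose T n := labs x n * labs y n.
  have TE n : T n = \sum_(z <- box n) nm (f z).
    by rewrite /T /labs -sum_box; apply: eq_bigr => z _; rewrite /f nmM.
  have Tc : cvgn T by apply: is_cvgM; apply: labs_cvg.
  apply: tendsto_squeeze (cvg_sub_double Tc) => n; rewrite subr0 !TE.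
  by apply: nm_sum_sub_le; rewrite ?box_uniq ?rotated_box_uniq //;
     [exact: box_sub_rotated | exact: rotated_box_sub].
have := tendstoD t2 t1; rewrite add0r; congr tendsto; apply/funext => n.
by rewrite /lsum -sum_box subrK.
Qed.

Lemma expz_rotate (a b : R[i]) (s t : int) : a != 0 -> b != 0 ->
  a ^ (s + t) * b ^ (s - t) = (a * b) ^ s * (a / b) ^ t.
Proof.
by move=> a0 b0; rewrite !expfzDr // !expfzMl exprz_inv; ring.
Qed.

Lemma lterm_even x y s t : x != 0 -> y != 0 ->
  lterm p (x * y) (s + t) * lterm p (x / y) (s - t) =
  lterm (p * p) (- (x * x)) s * lterm (p * p) (- (p * (y * y))) t.
Proof.
move=> x0 y0; rewrite /lterm !opprK.
have xy0 : - (x * y) != 0 by rewrite oppr_eq0 mulf_neq0.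
have xyV0 : - (x / y) != 0 by rewrite oppr_eq0 mulf_neq0 ?invr_eq0.
have e := expz_rotate s t xy0 xyV0.
have e1 : - (x * y) * - (x / y) = x * x by field.
have e2 : - (x * y) / - (x / y) = y * y by field; rewrite x0 y0.
rewrite e1 e2 in e; rewrite [(p * _) ^ t]expfzMl.
transitivity ((x * x) ^ s * (y * y) ^ t * (p ^+ trin (s + t) * p ^+ trin (s - t))).
  by rewrite -e; ring.
have -> : p ^+ trin (s + t) * p ^+ trin (s - t) =
   p ^ t * ((p * p) ^+ trin s * (p * p) ^+ trin t).
  rewrite -expr2 -!exprM -!exprD !exprnP -expfzDr //; congr (_ ^ _).
  have := trinE (s + t); have := trinE (s - t); have := trinE s; have := trinE t.
  move: (trin _) (trin _) (trin _) (trin _) => a b c d; nia.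
ring.
Qed.

Lemma lterm_odd x y s t : x != 0 -> y != 0 ->
  lterm p (x * y) (s + t + 1) * lterm p (x / y) (s - t) =
  - (x * y) * (lterm (p * p) (- (p * (x * x))) s *
               lterm (p * p) (- (p * p * (y * y))) t).
Proof.
move=> x0 y0; rewrite /lterm !opprK.
have xy0 : - (x * y) != 0 by rewrite oppr_eq0 mulf_neq0.
have xyV0 : - (x / y) != 0 by rewrite oppr_eq0 mulf_neq0 ?invr_eq0.
have e := expz_rotate s t xy0 xyV0.
have e1 : - (x * y) * - (x / y) = x * x by field.
have e2 : - (x * y) / - (x / y) = y * y by field; rewrite x0 y0.
rewrite e1 e2 in e; rewrite [(p * (x * x)) ^ s]expfzMl [(p * p * _) ^ t]expfzMl.
rewrite [(p * p) ^ t]expfzMl [_ ^ (s + t + 1)]expfzDr // expr1z.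
transitivity (- (x * y) * ((x * x) ^ s * (y * y) ^ t) *
   (p ^+ trin (s + t + 1) * p ^+ trin (s - t))).
  by rewrite -e; ring.
have -> : p ^+ trin (s + t + 1) * p ^+ trin (s - t) =
   p ^ s * (p ^ t * p ^ t) * ((p * p) ^+ trin s * (p * p) ^+ trin t).
  rewrite -[p * p]expr2 -!exprM -!exprD !exprnP -!expfzDr //; congr (_ ^ _).
  have := trinE (s + t + 1); have := trinE (s - t); have := trinE s; have := trinE t.
  move: (trin _) (trin _) (trin _) (trin _) => a b c d; nia.
ring.
Qed.

End ThetaProduct.

Section Weierstrass.
Local Open Scope classical_set_scope.
Local Open Scope ring_scope.
Variables (R : realType).
Implicit Types (p x y : R[i]).

Lemma nm_sqr_lt1 p : nm p < 1 -> nm (p * p) < 1.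
Proof. by move=> p1; rewrite nmM mulr_ilt1 // nm_ge0. Qed.

Lemma theta_pM p x : p != 0 -> x != 0 -> theta p (p * x) = theta p x^-1.
Proof. by move=> p0 x0; rewrite /theta invrK invfM mulVKf // mulrC. Qed.

(** The product as a combination of two separated terms with base [p ^ 2]:
    these are the even and the odd part of the double series. *)
Theorem theta_mul_theta p x y : nm p < 1 -> p != 0 -> x != 0 -> y != 0 ->
  (qpoch_inf p p) ^+ 2 * (theta p (x * y) * theta p (x / y)) =
  (qpoch_inf (p * p) (p * p)) ^+ 2 *
  (theta (p * p) (- (x * x)) * theta (p * p) (- (p * (y * y))) -
   x / y * (theta (p * p) (- (p * (x * x))) * theta (p * p) (- (y * y)))).
Proof.
move=> p1 p0 x0 y0; have pp1 := nm_sqr_lt1 p1.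
have pp0 : p * p != 0 by rewrite mulf_neq0.
have nz (a : R[i]) : a != 0 -> - (a * a) != 0 by move=> a0; rewrite oppr_eq0 mulf_neq0.
have nzp (a : R[i]) : a != 0 -> - (p * (a * a)) != 0.
  by move=> a0; rewrite oppr_eq0 ?mulf_neq0.
have yy0 : - (p * p * (y * y)) != 0 by rewrite oppr_eq0 ?mulf_neq0.
have t := rotated_box_tendsto p1 p0 (mulf_neq0 x0 y0) (mulf_neq0 x0 (invr_neq0 y0)).
have J a := @jacobi_triple_product R (p * p) pp1 pp0 a.
have t' := tendstoD (tendstoM (J _ (nz _ x0)) (J _ (nzp _ y0)))
  (tendstoM (tendsto_cst (- (x * y))) (tendstoM (J _ (nzp _ x0)) (J _ yy0))).
(* The odd part produces theta (- p ^ 2 y ^ 2), one period away from the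
   argument wanted. *)
have shift : theta (p * p) (- (p * p * (y * y))) =
    (y * y)^-1 * theta (p * p) (- (y * y)).
  have -> : - (p * p * (y * y)) = p * p * - (y * y) by rewrite mulrN.
  by rewrite theta_pM ?nz // thetaV ?nz // invrN opprK.
rewrite shift in t'.
have -> : (qpoch_inf p p) ^+ 2 * (theta p (x * y) * theta p (x / y)) =
  qpoch_inf p p * theta p (x * y) * (qpoch_inf p p * theta p (x / y)) by ring.
have fE : (fun n => \sum_(z <- rotated_box n)
      lterm p (x * y) z.1 * lterm p (x / y) z.2) =
    (fun n => lsum (p * p) (- (x * x)) n * lsum (p * p) (- (p * (y * y))) n +
       - (x * y) * (lsum (p * p) (- (p * (x * x))) n *
                    lsum (p * p) (- (p * p * (y * y))) n)).
  apply/funext => n; rewrite /rotated_box big_cat !big_map /= /lsum.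
  rewrite -2!sum_box mulr_sumr; congr (_ + _); apply: eq_bigr => z _.
    by rewrite lterm_even.
  by rewrite lterm_odd.
rewrite fE in t; rewrite (tendsto_unique t t').
by field; rewrite y0.
Qed.

Lemma theta_p0 x : theta 0 x = 1 - x.
Proof.
have n0 : nm (0 : R[i]) < 1 by rewrite nm0.
by rewrite /theta mul0r (qpoch_inf0 n0) (qpoch_inf_rec n0) mulr0 (qpoch_inf0 n0) !mulr1.
Qed.

(** The bilateral series requires [p != 0]; for [p = 0], theta is [1 - x] and
    the decomposition is immediate. *)
Lemma theta_rank2 p : nm p < 1 -> exists A B : R[i] -> R[i],
  forall x y, x != 0 -> y != 0 ->
  theta p (x * y) * theta p (x / y) = A x * B y - x / y * (B x * A y).
Proof.
move=> p1; have [->|p0] := eqVneq p 0.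
  exists (fun x => 1 + x * x), (fun=> 1) => x y x0 y0.
  by rewrite !theta_p0; field.
pose c := qpoch_inf (p * p) (p * p) / qpoch_inf p p.
exists (fun x => c * theta (p * p) (- (x * x))),
       (fun x => c * theta (p * p) (- (p * (x * x)))) => x y x0 y0.
have e0 := euler_neq0 p1.
apply: (mulfI (expf_neq0 2 e0)); rewrite theta_mul_theta // /c.
by field; rewrite e0 y0.
Qed.

(** With [s ^ 2 = a], replacing [x], [u] by [s x], [s u] and [y], [v] by
    [y / s], [v / s] turns every pair of factors into one of the form
    [theta (x y) theta (x / y)]; then [theta_rank2] makes the relation an
    identity between products of values of [A] and [B]. *)
Theorem theta_weierstrass p a x y u v : nm p < 1 ->
  a != 0 -> x != 0 -> y != 0 -> u != 0 -> v != 0 ->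
  theta p (x * y) * theta p (a * x / y) * (theta p (u * v) * theta p (a * u / v)) -
  theta p (x * v) * theta p (a * x / v) * (theta p (u * y) * theta p (a * u / y)) =
  a * u / y * (theta p (y * v / a) * theta p (y / v)) *
  (theta p (a * x * u) * theta p (x / u)).
Proof.
move=> p1 a0 x0 y0 u0 v0; have [A [B AB]] := theta_rank2 p1.
pose s := sqrtC a; have ss : s * s = a by rewrite -expr2 sqrtCK.
have s0 : s != 0 by apply: contraNneq a0 => s0; rewrite -ss s0 mul0r.
have E1 X Y : X != 0 -> Y != 0 -> theta p (X * Y) * theta p (a * X / Y) =
    A (s * X) * B (Y / s) - s * X / (Y / s) * (B (s * X) * A (Y / s)).
  move=> X0 Y0; rewrite -AB ?mulf_neq0 ?invr_eq0 //.
  by congr (theta p _ * theta p _); rewrite -?ss; field; rewrite ?s0 ?Y0.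
have E2 : theta p (y * v / a) * theta p (y / v) =
    A (y / s) * B (v / s) - (y / s) / (v / s) * (B (y / s) * A (v / s)).
  rewrite -AB ?mulf_neq0 ?invr_eq0 //.
  by congr (theta p _ * theta p _); rewrite -?ss; field; rewrite ?s0 ?v0.
have E3 : theta p (a * x * u) * theta p (x / u) =
    A (s * x) * B (s * u) - (s * x) / (s * u) * (B (s * x) * A (s * u)).
  rewrite -AB ?mulf_neq0 ?invr_eq0 //.
  by congr (theta p _ * theta p _); rewrite -?ss; field; rewrite ?s0 ?u0.
rewrite !E1 // E2 E3 -ss.
move: (A _) (A _) (A _) (A _) (B _) (B _) (B _) (B _) => A1 A2 A3 A4 B1 B2 B3 B4.
by field; rewrite s0 y0 u0 v0.
Qed.

End Weierstrass.

(** * From integer exponents and lists of parameters to natural exponents *)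

Section SmallProducts.
Variables (T : Type) (F : comPzSemiRingType) (f : T -> F).

Lemma prod_seq2 x1 x2 : \prod_(x <- [:: x1; x2]) f x = f x1 * f x2.
Proof. by rewrite !big_cons big_nil mulr1. Qed.

Lemma prod_seq3 x1 x2 x3 : \prod_(x <- [:: x1; x2; x3]) f x = f x1 * f x2 * f x3.
Proof. by rewrite !big_cons big_nil mulr1 !mulrA. Qed.

Lemma prod_seq5 x1 x2 x3 x4 x5 : \prod_(x <- [:: x1; x2; x3; x4; x5]) f x =
  f x1 * f x2 * f x3 * f x4 * f x5.
Proof. by rewrite !big_cons big_nil mulr1 !mulrA. Qed.

Lemma prod_seq6 x1 x2 x3 x4 x5 x6 :
  \prod_(x <- [:: x1; x2; x3; x4; x5; x6]) f x =
  f x1 * f x2 * f x3 * f x4 * f x5 * f x6.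
Proof. by rewrite !big_cons big_nil mulr1 !mulrA. Qed.

End SmallProducts.

Section Conversion.
Variables (R : realType) (q p : R[i]).
Hypothesis (q0 : q != 0).
Local Notation th := (theta p).
Local Notation pch := (poch q th).

Lemma theta_like_theta : nm p < 1 -> theta_like th.
Proof.
move=> p1; split=> [|x x0|a x y u v *]; first exact: theta1.
  exact: thetaV.
exact: theta_weierstrass.
Qed.

Lemma tfactE a (l : nat) : tfact q p a l%:Z = pch a l.
Proof. by rewrite /tfact /poch big_mkord. Qed.

Lemma tfactsE s (l : nat) : tfacts q p s l%:Z = \prod_(a <- s) pch a l.
Proof. by apply: eq_bigr => a _; rewrite tfactE. Qed.

(** The factors [u] of the pairings account for the weight
    [2 j] in the exponents [2 j + 1] of the sum. *)
Lemma prod_pairs_snd n (x : 'I_n -> R[i]) :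
  \prod_(i < n) \prod_(j < n | (i < j)%N) x j = \prod_(j < n) x j ^+ j.
Proof.
rewrite (exchange_big_dep xpredT) //=; apply: eq_bigr => j _.
rewrite -(big_ord_widen n (fun=> x j)) ?(ltnW (ltn_ord j)) //.
by rewrite prodr_const card_ord.
Qed.

Lemma expz_subn (i j : nat) (u : int) : u = i%:Z - j%:Z -> q ^ u = q ^+ i / q ^+ j.
Proof. by move=> ->; rewrite expfzDr // -exprnN -exprnP. Qed.

Lemma multi_sum_tfacts a b c d n m : a != 0 -> b != 0 -> c != 0 -> d != 0 ->
  \sum_(k : {ffun 'I_n.+1 -> 'I_m.+1} | strictly_increasing k)
     q ^+ (\sum_(i < n.+1) (2 * i.+1 - 1) * k i)%N *
     (\prod_(i < n.+1) \prod_(j < n.+1 | (i < j)%N)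
        thetas p [:: q ^ ((k i)%:Z - (k j)%:Z); a * q ^+ (k i + k j)] ^+ 2) *
     (\prod_(i < n.+1)
        ((theta p (a * q ^+ (2 * k i)) *
          tfacts q p
            [:: a; b; c; d;
                a ^+ 2 * q ^ (3 - 2 * n.+1%:Z + m%:Z) / (b * c * d);
                q ^- m]
            (k i)%:Z) /
         (theta p a *
          tfacts q p
            [:: q; a * q / b; a * q / c; a * q / d;
                b * c * d * q ^ (2 * n.+1%:Z - 2 - m%:Z) / a;
                a * q ^ (1 + m%:Z)]
            (k i)%:Z))) =
  multi_sum q th a b c d (a ^+ 2 * q ^+ m.+1 / (b * c * d * q ^+ (2 * n))) n m.
Proof.
move=> a0 b0 c0 d0; apply: eq_bigr => k _.
have qX i : q ^+ i != 0 by rewrite expf_neq0.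
set e := a ^+ 2 * q ^+ m.+1 / _.
have -> : a ^+ 2 * q ^ (3 - 2 * n.+1%:Z + m%:Z) / (b * c * d) = e.
  by rewrite (@expz_subn m.+1 (2 * n)) /e; [fieldnz | lia].
have -> : b * c * d * q ^ (2 * n.+1%:Z - 2 - m%:Z) / a = a * q / e.
  rewrite (@expz_subn (2 * n) m) /e; [rewrite (exprS q m) | by lia].
  fieldnz.
have -> : a * q ^ (1 + m%:Z) = a * q ^+ m.+1 by [].
have -> : \prod_(i < n.+1) \prod_(j < n.+1 | (i < j)%N)
    pair_br th a (q ^+ k i) (q ^+ k j) =
  q ^+ (\sum_(j < n.+1) j * k j)%N *
  \prod_(i < n.+1) \prod_(j < n.+1 | (i < j)%N)
        thetas p [:: q ^ ((k i)%:Z - (k j)%:Z); a * q ^+ (k i + k j)].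
  rewrite expr_sum; under [in RHS]eq_bigr do rewrite mulnC exprM.
  rewrite -prod_pairs_snd -big_split; apply: eq_bigr => i _ /=.
  rewrite -big_split; apply: eq_bigr => j _ /=.
  rewrite /pair_br /thetas prod_seq2 (@expz_subn (k i) (k j)) //.
  by rewrite exprD [a * (_ * _)]mulrA; congr (_ * _); rewrite mulrC.
rewrite exprMn -exprM.
have -> : \prod_(i < n.+1) vwp_term q th a b c d e m (k i) =
   q ^+ (\sum_(i < n.+1) k i)%N * \prod_(i < n.+1)
        ((theta p (a * q ^+ (2 * k i)) *
          tfacts q p [:: a; b; c; d; e; q ^- m] (k i)%:Z) /
         (theta p a *
          tfacts q p [:: q; a * q / b; a * q / c; a * q / d; a * q / e;
                a * q ^+ m.+1] (k i)%:Z)).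
  rewrite expr_sum -big_split; apply: eq_bigr => i _ /=.
  by rewrite !tfactsE !prod_seq6 /vwp_term [RHS]mulrC.
rewrite mulrACA -exprD mulrA; congr (_ * _ * _).
  congr (_ ^+ _); rewrite big_distrl -big_split; apply: eq_bigr => i _ /=; lia.
rewrite -prodrXl; apply: eq_bigr => i _; rewrite -prodrXl.
by [].
Qed.

Lemma multi_closed_tfacts a b c d n m : (n <= m)%N ->
  a != 0 -> b != 0 -> c != 0 -> d != 0 ->
  q ^- (4 * 'C(n.+1, 3)) * (a / (b * c * d * q)) ^+ 'C(n.+1, 2) *
  (\prod_(1 <= i < n.+2)
     tfacts q p
       [:: q; b; c; d; a ^+ 2 * q ^ (3 - 2 * n.+1%:Z + m%:Z) / (b * c * d)]
       (i%:Z - 1)) *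
  (\prod_(1 <= i < n.+2)
     ((tfacts q p [:: q; a * q] m%:Z *
       tfacts q p
         [:: a * q ^ (2 - i%:Z) / (b * c); a * q ^ (2 - i%:Z) / (b * d);
             a * q ^ (2 - i%:Z) / (c * d)]
         (m%:Z + 1 - n.+1%:Z)) /
      tfacts q p
        [:: q; a * q / b; a * q / c; a * q / d;
            a * q ^ (2 - 2 * n.+1%:Z + i%:Z) / (b * c * d)]
        (m%:Z + 1 - i%:Z))) =
  multi_closed q th a b c d (a ^+ 2 * q ^+ m.+1 / (b * c * d * q ^+ (2 * n))) n m.
Proof.
move=> le_nm a0 b0 c0 d0; rewrite /multi_closed [RHS]mulrC -mulrA.
have qX i : q ^+ i != 0 by rewrite expf_neq0.
set e := a ^+ 2 * q ^+ m.+1 / _.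
have -> : a ^+ 2 * q ^ (3 - 2 * n.+1%:Z + m%:Z) / (b * c * d) = e.
  by rewrite (@expz_subn m.+1 (2 * n)) /e; [fieldnz | lia].
congr (_ * _ * _).
  by congr (_ ^+ _); fieldnz.
rewrite !big_add1 !big_mkord -big_split; apply: eq_bigr => i _ /=.
have le_in : (i <= n)%N by rewrite -ltnS.
have -> : i.+1%:Z - 1 = i%:Z by lia.
have -> : m%:Z + 1 - n.+1%:Z = (m - n)%N%:Z by lia.
have -> : m%:Z + 1 - i.+1%:Z = (m - i)%N%:Z by lia.
rewrite (@expz_subn 1 i (2 - i.+1%:Z)); last by lia.
rewrite (@expz_subn i.+1 (2 * n) (2 - 2 * n.+1%:Z + i.+1%:Z)); last by lia.
have E x : a * (q ^+ 1 / q ^+ i) / x = a * q / x / q ^+ i by rewrite expr1; ring.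
have E' : a * (q ^+ i.+1 / q ^+ (2 * n)) / (b * c * d) =
    a * q ^+ i.+1 / (b * c * d * q ^+ (2 * n)) by fieldnz.
rewrite !E E' !tfactsE !prod_seq5 prod_seq3 prod_seq2.
exact: mulrA.
Qed.

End Conversion.

(** * Arbitrary parameters as limits of generic ones *)

Section Perturbation.
Local Open Scope classical_set_scope.
Local Open Scope ring_scope.
Variables (R : realType) (q p : R[i]).
Hypothesis (q0 : q != 0) (p1 : nm p < 1).
Local Notation th := (theta p).
Local Notation gen := (generic q th).

Lemma subset1_countable (T : pointedType) (A : set T) :
  (forall x y, A x -> A y -> x = y) -> countable A.
Proof.
move=> A1; have [->|/set0P[x Ax]] := eqVneq A set0; first exact: countable0.
apply: (sub_countable _ (countable1 x)); apply: subset_card_le => y Ay /=.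
exact: A1.
Qed.

(** A zero of theta is a power of [p], so each pair of shifts and each power
    determine [t ^ N] and hence the positive number [t]. *)
Lemma countable_nongeneric (K : R[i]) (N : nat) : K != 0 -> (0 < N)%N ->
  countable [set t : R | 0 < t /\ ~ gen (K * t%:C ^+ N)].
Proof.
move=> K0 N0.
pose F (z : nat * nat * int) := [set t : R | 0 < t /\
   nm K * t ^+ N * (nm q ^+ z.1.1 / nm q ^+ z.1.2) = nm (p ^ z.2)].
apply: (@sub_countable _ _ _ (\bigcup_(z in setT) F z)); last first.
  apply: bigcup_countable => [|z _]; first exact: countableP.
  apply: subset1_countable => t u [t0 ht] [u0 hu].
  have c0 : nm K * (nm q ^+ z.1.1 / nm q ^+ z.1.2) != 0.
    by rewrite !mulf_neq0 ?invr_eq0 ?expf_neq0 // nm_eq0.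
  have e : t ^+ N = u ^+ N.
    by apply: (mulIf c0); rewrite ![_ ^+ N * (nm K * _)]mulrCA !mulrA in ht hu *; rewrite ht hu.
  by apply/eqP; rewrite -(eqrXn2 N0 (ltW t0) (ltW u0)) e.
apply: subset_card_le => t [t0 /existsNP[i /existsNP[j]]].
move=> /negP; rewrite negbK => /eqP h.
have x0 : K * t%:C ^+ N * q ^+ i / q ^+ j != 0.
  by rewrite !mulf_neq0 ?invr_eq0 ?expf_neq0 // -nm_eq0 nm_real gtr0_norm // gt_eqF.
have [k hk] := theta_eq0 p1 x0 h.
exists (i, j, k) => //; split=> //=.
rewrite -hk !nmM nmV !nmX nm_real gtr0_norm //.
by rewrite !mulrA.
Qed.

(** A nonempty interval has positive Lebesgue measure and is therefore not
    covered by countably many exceptional values. *)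
Lemma exists_generic (s : seq (R[i] * nat)) (eps : R) : 0 < eps ->
  (forall z, z \in s -> z.1 != 0 /\ (0 < z.2)%N) ->
  exists t : R, [/\ 1 < t, t < 1 + eps &
    forall z, z \in s -> gen (z.1 * t%:C ^+ z.2)].
Proof.
move=> eps0 hs; apply: contrapT => /forallNP none.
have : countable [set` `]1, 1 + eps[].
  apply: (@sub_countable _ _ _ (\bigcup_(z in [set` s])
     [set t : R | 0 < t /\ ~ gen (z.1 * t%:C ^+ z.2)])); last first.
    apply: bigcup_countable => [|z zs].
      exact/finite_set_countable/finite_seq.
    by have [z0 N0] := hs z zs; apply: countable_nongeneric.
  apply: subset_card_le => t; rewrite /= in_itv /= => /andP[t1 t2].
  apply: contrapT => h; apply: (none t); split=> // z zs.
  apply: contrapT => ng; apply: h; exists z => //; split=> //.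
  exact: lt_trans t1.
move/countable_lebesgue_measure0; rewrite lebesgue_measure_itv /= lte_fin.
by rewrite ltrDl eps0 -EFinD => -[] /eqP; rewrite addrAC subrr add0r gt_eqF.
Qed.

Lemma generic_sequence (s : seq (R[i] * nat)) :
  (forall z, z \in s -> z.1 != 0 /\ (0 < z.2)%N) ->
  exists u : nat -> R[i], [/\ tendsto u 1, forall n, u n != 0 &
    forall n z, z \in s -> gen (z.1 * u n ^+ z.2)].
Proof.
move=> hs.
have ex n : exists t : R, [/\ 1 < t, t < 1 + n.+1%:R^-1 &
    forall z, z \in s -> gen (z.1 * t%:C ^+ z.2)].
  by apply: exists_generic => //; rewrite invr_gt0.
have [f hf] := choice ex; exists (fun n => (f n)%:C); split=> [|n|n].
- apply: (@tendsto_squeeze _ _ _ (fun n => n.+1%:R^-1)) => [n|]; last exact: cvg_harmonic.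
  have [h1 h2 _] := hf n.
  have -> : (f n)%:C - 1 = (f n - 1)%:C by rewrite rmorphB.
  rewrite nm_real.
  by rewrite ger0_norm ?subr_ge0 ?(ltW h1) // lerBlDl (ltW h2).
- have [h1 _ _] := hf n; rewrite -nm_eq0 nm_real normr_eq0 gt_eqF //.
  exact: lt_trans h1.
by have [_ _] := hf n.
Qed.

End Perturbation.

Section Limits.
Local Open Scope classical_set_scope.
Local Open Scope ring_scope.
Variables (R : realType) (q p : R[i]).
Hypothesis (q0 : q != 0) (p1 : nm p < 1).
Local Notation th := (theta p).
Local Notation pch := (poch q th).
Local Notation gen := (generic q th).

Lemma tendsto_theta (u : nat -> R[i]) x :
  x != 0 -> tendsto u x -> tendsto (fun i => th (u i)) (th x).
Proof. by move=> x0 ux; apply: theta_continuous. Qed.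

Lemma tendsto_poch (u : nat -> R[i]) x k :
  x != 0 -> tendsto u x -> tendsto (fun i => pch (u i) k) (pch x k).
Proof.
move=> x0 ux; apply: tendsto_prod => j _; apply: tendsto_theta.
  by nonzero.
exact: (tendstoM ux (tendsto_cst _)).
Qed.

Lemma tendsto_div (u v : nat -> R[i]) x y : y != 0 ->
  tendsto u x -> tendsto v y -> tendsto (fun i => u i / v i) (x / y).
Proof. by move=> y0 ux vy; exact: (tendstoM ux (tendstoV y0 vy)). Qed.

Ltac limit :=
  repeat first
    [ assumption
    | match goal with |- tendsto (fun=> ?c) ?c => exact: tendsto_cst end
    | match goal with |- tendsto (fun i => @?f i / @?g i) (?x / ?y) =>
        refine (@tendsto_div f g x y _ _ _); [by nonzero| |] end
    | match goal with |- tendsto (fun i => @?f i * @?g i) (?x * ?y) =>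
        refine (@tendstoM _ f g x y _ _) end
    | match goal with |- tendsto (fun i => @?f i ^+ ?k) (?x ^+ ?k) =>
        refine (@tendstoX _ f x k _) end
    | match goal with |- tendsto (fun i => th (@?f i)) (th ?x) =>
        refine (@tendsto_theta f x _ _); [by nonzero|] end
    | match goal with |- tendsto (fun i => pch (@?f i) ?k) (pch ?x ?k) =>
        refine (@tendsto_poch f x k _ _); [by nonzero|] end ].

Lemma tendsto_vwp_term (ua ub uc ud ue : nat -> R[i]) a b c d e m k :
  a != 0 -> b != 0 -> c != 0 -> d != 0 -> e != 0 ->
  tendsto ua a -> tendsto ub b -> tendsto uc c -> tendsto ud d -> tendsto ue e ->
  th a != 0 -> pch q k * pch (a * q / b) k * pch (a * q / c) k *
     pch (a * q / d) k * pch (a * q / e) k * pch (a * q ^+ m.+1) k != 0 ->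
  tendsto (fun i => vwp_term q th (ua i) (ub i) (uc i) (ud i) (ue i) m k)
    (vwp_term q th a b c d e m k).
Proof.
move=> a0 b0 c0 d0 e0 ha hb hc hd he ta D; rewrite /vwp_term.
limit.
Qed.

Lemma tendsto_lhs (ua ub uc ud ue : nat -> R[i]) a b c d e n m :
  a != 0 -> b != 0 -> c != 0 -> d != 0 -> e != 0 ->
  tendsto ua a -> tendsto ub b -> tendsto uc c -> tendsto ud d -> tendsto ue e ->
  th a != 0 ->
  (forall k, (k <= m)%N -> pch q k * pch (a * q / b) k * pch (a * q / c) k *
     pch (a * q / d) k * pch (a * q / e) k * pch (a * q ^+ m.+1) k != 0) ->
  tendsto (fun i => multi_sum q th (ua i) (ub i) (uc i) (ud i) (ue i) n m)
    (multi_sum q th a b c d e n m).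
Proof.
move=> a0 b0 c0 d0 e0 ha hb hc hd he ta D; apply: tendsto_sum => k _.
apply: tendstoM.
  apply: tendstoX; apply: tendsto_prod => i _; apply: tendsto_prod => j _.
  by rewrite /pair_br; limit.
apply: tendsto_prod => i _; apply: tendsto_vwp_term => //.
by apply: D; rewrite -ltnS.
Qed.

Lemma tendsto_rhs (ua ub uc ud ue : nat -> R[i]) a b c d e n m :
  a != 0 -> b != 0 -> c != 0 -> d != 0 -> e != 0 ->
  tendsto ua a -> tendsto ub b -> tendsto uc c -> tendsto ud d -> tendsto ue e ->
  (forall i, (i <= n)%N -> pch q (m - i) * pch (a * q / b) (m - i) *
     pch (a * q / c) (m - i) * pch (a * q / d) (m - i) *
     pch (a * q ^+ i.+1 / (b * c * d * q ^+ (2 * n))) (m - i) != 0) ->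
  tendsto (fun i => multi_closed q th (ua i) (ub i) (uc i) (ud i) (ue i) n m)
    (multi_closed q th a b c d e n m).
Proof.
move=> a0 b0 c0 d0 e0 ha hb hc hd he D; rewrite /multi_closed.
apply: tendstoM; last by limit.
apply: tendsto_prod => i _; have D' := D i (leq_ord i).
limit.
Qed.

(** Both sides are continuous at parameters for which no denominator vanishes,
    and they agree along a sequence of generic parameters. *)
Theorem multi_sum_theta a b c d e m n :
  e = a ^+ 2 * q ^+ m.+1 / (b * c * d * q ^+ (2 * n)) -> (n <= m)%N ->
  a != 0 -> b != 0 -> c != 0 -> d != 0 -> th a != 0 ->
  (forall k, (k <= m)%N -> pch q k * pch (a * q / b) k * pch (a * q / c) k *
     pch (a * q / d) k * pch (a * q / e) k * pch (a * q ^+ m.+1) k != 0) ->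
  multi_sum q th a b c d e n m = multi_closed q th a b c d e n m.
Proof.
move=> def_e le_nm a0 b0 c0 d0 ta D.
have e0 : e != 0 by rewrite def_e; nonzero.
have thP := theta_like_theta p1.
have gq i : (0 < i <= m)%N -> th (q ^+ i) != 0.
  by apply: theta_qX_neq0 => k /D; apply: prod6_neq0l.
(* All the exponents of t obtained from a t ^ 7, b t, c t ^ 2, d t ^ 3 must be
   nonzero; the quotients are written so that they are positive. *)
pose s := [:: (a, 7%N); (c, 2%N); (e, 8%N); (a / b, 6%N); (a / c, 5%N);
  (a / d, 4%N); (a / (b * c * d), 1%N); (a / (b * c), 4%N); (c / b, 1%N);
  (e / d, 5%N); (a / (b * d), 3%N); (a / (c * d), 2%N)].
have hs z : z \in s -> z.1 != 0 /\ (0 < z.2)%N.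
  rewrite !inE; do !(case/orP => [/eqP->|]); try (move/eqP->);
    by split=> //=; nonzero.
have [u hu3] := @generic_sequence R q p q0 p1 s hs.
have u1 : tendsto u 1 by case: hu3.
have u0 : forall i, u i != 0 by case: hu3.
have hu : forall i z, z \in s -> gen (z.1 * u i ^+ z.2) by case: hu3.
have uX k : tendsto (fun i => u i ^+ k) 1 by rewrite -(expr1n _ k); apply: tendstoX.
have tX x k : tendsto (fun i => x * u i ^+ k) x.
  by rewrite -[X in tendsto _ X]mulr1; apply: (tendstoM (tendsto_cst x)).
have L := tendsto_lhs n a0 b0 c0 d0 e0 (tX a 7) (tX b 1) (tX c 2) (tX d 3)
  (tX e 8) ta D.
have Dr i (_ : (i <= n)%N) := closed_denom_neq0 i q0 thP def_e a0 b0 c0 d0 D.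
have Rt := tendsto_rhs a0 b0 c0 d0 e0 (tX a 7) (tX b 1) (tX c 2) (tX d 3)
  (tX e 8) Dr.
apply: tendsto_unique L _; move: Rt; congr tendsto; apply/funext => i.
have ui := u0 i.
have hg z N x : (z, N) \in s -> x = z * u i ^+ N -> gen x.
  by move=> zs ->; have := hu i _ zs.
symmetry; apply: (multi_sum_generic q0 (theta_like_theta p1)) => //; try by nonzero.
- by rewrite def_e; fieldnz.
- by apply: (hg a 7%N); rewrite ?inE ?eqxx ?orbT.
- by apply: (hg c 2%N); rewrite ?inE ?eqxx ?orbT.
- by apply: (hg e 8%N); rewrite ?inE ?eqxx ?orbT.
- by apply: (hg (a / b) 6%N); [rewrite ?inE ?eqxx ?orbT | fieldnz].
- by apply: (hg (a / c) 5%N); [rewrite ?inE ?eqxx ?orbT | fieldnz].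
- by apply: (hg (a / d) 4%N); [rewrite ?inE ?eqxx ?orbT | fieldnz].
- by apply: (hg (a / (b * c * d)) 1%N); [rewrite ?inE ?eqxx ?orbT | fieldnz].
- by apply: (hg (a / (b * c)) 4%N); [rewrite ?inE ?eqxx ?orbT | fieldnz].
- by apply: (hg (c / b) 1%N); [rewrite ?inE ?eqxx ?orbT | fieldnz].
- by apply: (hg (e / d) 5%N); [rewrite ?inE ?eqxx ?orbT | fieldnz].
- by apply: (hg (a / (b * d)) 3%N); [rewrite ?inE ?eqxx ?orbT | fieldnz].
- by apply: (hg (a / (c * d)) 2%N); [rewrite ?inE ?eqxx ?orbT | fieldnz].
Qed.

End Limits.

(** * The multiple Jackson sum *)

(** The factorial contains the factor [theta 1 = 0]. *)
Lemma tfact_qneg (R : realType) (q p : R[i]) (l : nat) :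
  q != 0 -> nm p < 1 -> tfact q p q (Negz l) = 0.
Proof.
move=> q0 p1; rewrite /tfact big_nat_recr //=.
have -> : q * q ^ (Negz l + l%:Z) = 1.
  have -> : Negz l + l%:Z = -1 by lia.
  by rewrite exprN1 divff.
by rewrite theta1 // mulr0 invr0.
Qed.

Lemma strictly_increasing_empty r m (k : {ffun 'I_r -> 'I_m.+1}) :
  (m.+1 < r)%N -> strictly_increasing k = false.
Proof.
move=> lt_mr; apply/negP => /strictly_increasing_inj/leq_card.
by rewrite !card_ord leqNgt lt_mr.
Qed.

(* In the sum, i : 'I_r is 0-based, so the paper's 2i-1 reads 2 * i.+1 - 1.
   The two hypotheses on denominators cover the right-hand side as well: the
   factors of (aq^(2-2r+i)/bcd; q, p)_(m+1-i) are, up to units, factors of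
   (bcdq^(2r-2-m)/a; q, p)_m, because theta(1/x) = - theta(x) / x. *)
Theorem theorem3p1 (R : realType) (q p a b c d : R[i]) (m r : nat)
    (q_neq0 : q != 0) (p_lt1 : `|p| < 1)
    (a_neq0 : a != 0) (b_neq0 : b != 0) (c_neq0 : c != 0) (d_neq0 : d != 0)
    (r_ge1 : (1 <= r)%N)
    (theta_a_neq0 : theta p a != 0)
    (denom_neq0 : forall k : nat, (k <= m)%N ->
       tfacts q p
         [:: q; a * q / b; a * q / c; a * q / d;
             b * c * d * q ^ (2 * r%:Z - 2 - m%:Z) / a; a * q ^ (1 + m%:Z)]
         k%:Z != 0) :
  \sum_(k : {ffun 'I_r -> 'I_m.+1} | strictly_increasing k)
     q ^+ (\sum_(i < r) (2 * i.+1 - 1) * k i)%N *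
     (\prod_(i < r) \prod_(j < r | (i < j)%N)
        thetas p [:: q ^ ((k i)%:Z - (k j)%:Z); a * q ^+ (k i + k j)] ^+ 2) *
     (\prod_(i < r)
        ((theta p (a * q ^+ (2 * k i)) *
          tfacts q p
            [:: a; b; c; d;
                a ^+ 2 * q ^ (3 - 2 * r%:Z + m%:Z) / (b * c * d);
                q ^- m]
            (k i)%:Z) /
         (theta p a *
          tfacts q p
            [:: q; a * q / b; a * q / c; a * q / d;
                b * c * d * q ^ (2 * r%:Z - 2 - m%:Z) / a;
                a * q ^ (1 + m%:Z)]
            (k i)%:Z)))
  =
  q ^- (4 * 'C(r, 3)) * (a / (b * c * d * q)) ^+ 'C(r, 2) *
  (\prod_(1 <= i < r.+1)
     tfacts q p
       [:: q; b; c; d; a ^+ 2 * q ^ (3 - 2 * r%:Z + m%:Z) / (b * c * d)]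
       (i%:Z - 1)) *
  (\prod_(1 <= i < r.+1)
     ((tfacts q p [:: q; a * q] m%:Z *
       tfacts q p
         [:: a * q ^ (2 - i%:Z) / (b * c); a * q ^ (2 - i%:Z) / (b * d);
             a * q ^ (2 - i%:Z) / (c * d)]
         (m%:Z + 1 - r%:Z)) /
      tfacts q p
        [:: q; a * q / b; a * q / c; a * q / d;
            a * q ^ (2 - 2 * r%:Z + i%:Z) / (b * c * d)]
        (m%:Z + 1 - i%:Z))).
Proof.
have p1 : nm p < 1 by move: p_lt1; rewrite nmE ltcE /= => /andP[].
case: (leqP r m.+1) => [le_rm|lt_mr]; last first.
  rewrite [LHS]big_pred0; last by move=> k; exact: strictly_increasing_empty.
  rewrite [\prod_(1 <= i < r.+1) (_ / _)]big_nat_recr //=.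
  have -> : m%:Z + 1 - r%:Z = Negz (r - m.+2)%N by lia.
  rewrite [X in _ / X](_ : _ = 0); first by rewrite invr0 !mulr0.
  by rewrite /tfacts big_cons tfact_qneg // mul0r.
case: r r_ge1 denom_neq0 le_rm => // n _ denom_neq0 le_nm.
rewrite multi_sum_tfacts // multi_closed_tfacts //; apply: multi_sum_theta => // k le_km.
have := denom_neq0 k le_km; rewrite tfactsE prod_seq6.
have -> : b * c * d * q ^ (2 * n.+1%:Z - 2 - m%:Z) / a =
  a * q / (a ^+ 2 * q ^+ m.+1 / (b * c * d * q ^+ (2 * n))).
  rewrite (@expz_subn _ q q_neq0 (2 * n) m); last by lia.
  by rewrite (exprS q m); fieldnz.
by [].
Qed.
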